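(* The Shapovalov scalar product of the Whittaker vectors equals, for every $\underline d$, $$(\mathfrak k_{\underline d},\mathfrak w_{\underline d})=(-1)^{\sum_{i=1}^{n-1}d_i}\,v^{\sum_{i=1}^{n-1}d_i^2-\sum_{i=2}^{n-1}d_id_{i-1}-\sum_{i=1}^{n-1}d_i}\prod_{i=1}^nt_i^{d_{i-1}-d_i}\,[R\Gamma(\mathfrak Q_{\underline d},\mathcal O_{\mathfrak Q_{\underline d}})].$$
   Context: Work over $\mathbb C$; $n\ge2$. Geometry: $\mathbf C=\mathbb P^1$ with coordinate $z$ and points $0,\infty$; $\mathbb C^*$ acts by $v(z)=v^{-2}z$. $W$ is a vector space with basis $w_1,\dots,w_n$; the torus $\widetilde T=\{(t_1,\dots,t_n): t_1\cdots t_n=1\}$ acts on $W$ by $\underline t(w_i)=t_i^2w_i$. For $\underline d=(d_1,\dots,d_{n-1})\in\mathbb Z_{\ge0}^{n-1}$ (with $d_0=d_n=0$), $\mathfrak Q_{\underline d}$ is the moduli space of flags of locally free subsheaves $0\subset\mathcal W_1\subset\dots\subset\mathcal W_{n-1}\subset W\otimes\mathcal O_{\mathbf C}$ with $\operatorname{rank}\mathcal W_k=k$, $\deg\mathcal W_k=-d_k$, such that near $\infty$ each $\mathcal W_i$ is a vector subbundle with fibre $\langle w_1,\dots,w_i\rangle$ at $\infty$. It is a smooth quasiprojective variety of dimension $2\sum d_i$ with an action of $\widetilde T\times\mathbb C^*$ (it is empty if some $d_i<0$). Write $\underline d\pm i$ for $\underline d$ with $d_i$ replaced by $d_i\pm1$.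 $\mathfrak E_{\underline d,i}\subset\mathfrak Q_{\underline d}\times\mathfrak Q_{\underline d+i}$ is the (smooth) correspondence of pairs $(\mathcal W_\bullet,\mathcal W'_\bullet)$ with $\mathcal W_j=\mathcal W'_j$ for $j\ne i$ and $\mathcal W'_i\subset\mathcal W_i$; $\mathbf p,\mathbf q$ are its projections to $\mathfrak Q_{\underline d}$ and $\mathfrak Q_{\underline d+i}$; $\mathfrak L_i$ is the line bundle on it with fibre $\Gamma(\mathbf C,\mathcal W_i/\mathcal W'_i)$. $K$-theory: $\mathbb F=\operatorname{Frac}(\mathbb C[\widetilde T\times\mathbb C^*])$, with $\mathbb C[\widetilde T\times\mathbb C^*]=\mathbb C[t_1^{\pm1},\dots,t_n^{\pm1},v^{\pm1}]/(t_1\cdots t_n-1)$. $M_{\underline d}=K^{\widetilde T\times\mathbb C^*}(\mathfrak Q_{\underline d})\otimes\mathbb F$ (complexified equivariant $K$-theory, localized) and $M=\bigoplus_{\underline d}M_{\underline d}$. The $\widetilde T\times\mathbb C^*$-fixed points of $\mathfrak Q_{\underline d}$ are indexed by collections $\widetilde{\underline d}=(d_{ij})_{1\le j\le i\le n-1}$ of nonnegative integers with $d_i=\sum_{j\le i}d_{ij}$ and $d_{kj}\ge d_{ij}$ for $i\ge k\ge j$; the corresponding flag is $\mathcal W_i=\bigoplus_{j\le i}\mathcal O_{\mathbf C}(-d_{ij}\cdot0)w_j$. The classes $[\widetilde{\underline d}]$ of the structure sheaves of the fixed points form an $\mathbb F$-basis of $M$. Convention for characters and direct images: the function $z$ has character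 $v^{-2}$ and $w_i$ has character $t_i^2$, so e.g. $\operatorname{Hom}(\mathcal O_{\mathbf C}(-a\cdot 0),\mathcal O_{\mathbf C})$ has character $\sum_{c=0}^av^{2c}$. At a fixed point $x$ of a smooth variety $X$ put $S\chi_x=\prod_\chi(1-\chi)^{-1}$, the product over the weights $\chi$ of $T_xX$ (the character of $\operatorname{Sym}^\bullet T_xX$). Direct images are defined by localization: $\mathbf p_*\mathbf q^*[\widetilde{\underline d}{}']=\sum_{\widetilde{\underline d}}\frac{S\chi_{(\widetilde{\underline d},\widetilde{\underline d}{}')}}{S\chi_{\widetilde{\underline d}{}'}}[\widetilde{\underline d}]$ and $\mathbf q_*(\mathfrak L_i\otimes\mathbf p^* )[\widetilde{\underline d}]=\sum_{\widetilde{\underline d}{}'}\lambda\,\frac{S\chi_{(\widetilde{\underline d},\widetilde{\underline d}{}')}}{S\chi_{\widetilde{\underline d}}}[\widetilde{\underline d}{}']$, sums over fixed points $(\widetilde{\underline d},\widetilde{\underline d}{}')$ of $\mathfrak E_{\underline d,i}$, $\lambda$ the character of the fibre of $\mathfrak L_i$ there; and the formal character $[R\Gamma(\mathfrak Q_{\underline d},\mathcal O_{\mathfrak Q_{\underline d}})]\in\mathbb F$ is $\sum_xS\chi_x$, sum over the fixed points $x$ of $\mathfrak Q_{\underline d}$. Operators, for $1\le i\le n-1$, given by their restriction to $M_{\underline d}$: $K_i=t_{i+1}t_i^{-1}v^{2d_i-d_{i-1}-d_{i+1}+1}:M_{\underline d}\to M_{\underline d}$; $f_i=\mathbf p_*\mathbf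 q^*:M_{\underline d}\to M_{\underline d-i}$; $e_i=-t_{i+1}^{-1}t_i^{-1}v^{d_{i+1}-d_{i-1}}\,\mathbf q_*(\mathfrak L_i\otimes\mathbf p^* ):M_{\underline d}\to M_{\underline d+i}$. Put $E_i=e_iK_i^{-i}$, $F_i=K_i^if_i$; the $E_i,F_i$ make $M$ the universal Verma module over $U_v(\mathfrak{sl}_n)$ with lowest weight vector $[(0,\dots,0)]$. The Shapovalov form on $M$ is the symmetric $\mathbb F$-bilinear form with $([(0,\dots,0)],[(0,\dots,0)])=1$ and $(E_ix,y)=(x,F_iy)$; $e_i^*$ denotes the adjoint of $e_i$ with respect to it, so $e_i^*=K_i^{2i}f_i$. Whittaker vectors: in the completion $\prod_{\underline d}M_{\underline d}$ of $M$ there is a unique vector $\mathfrak k=\sum_{\underline d}\mathfrak k_{\underline d}$ (resp. $\mathfrak w=\sum_{\underline d}\mathfrak w_{\underline d}$), with $\mathfrak k_{\underline d},\mathfrak w_{\underline d}\in M_{\underline d}$, such that $\mathfrak k_{(0,\dots,0)}=\mathfrak w_{(0,\dots,0)}=[(0,\dots,0)]$ and $f_i\mathfrak k=(1-v^2)^{-1}\mathfrak k$ (resp. $e_i^*\mathfrak w=(1-v^2)^{-1}\mathfrak w$) for all $1\le i\le n-1$. *)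

(* Defs.v *)
From HB Require Import structures.
From mathcomp Require Import all_boot all_order all_algebra fraction.
From mathcomp Require Import finmap.
From mathcomp Require Import classical_sets fsbigop reals complex monalg.
From mathcomp Require mpoly.

Set Implicit Arguments.
Unset Strict Implicit.
Unset Printing Implicit Defensive.

Import Order.TTheory GRing.Theory Num.Theory.
Local Open Scope ring_scope.

(** * Degrees and torus-fixed points

    All indices are 1-based, as in the usual notation. *)

Section Combinatorics.
Variable n : nat.

Definition degree := (n.-1).-tuple nat.

(** [crd d k] is [d_k]; in particular [d_0 = 0] and [d_k = 0] for [k >= n]. *)
Definition crd (d : seq nat) (k : nat) : nat := nth 0 (0 :: d) k.

Definition deg0 : degree := [tuple 0%N | k < n.-1].

(** [d + i] *)
Definition deg_incr (d : degree) (i : nat) : degree :=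
  [tuple (crd d k.+1 + (k.+1 == i))%N | k < n.-1].

(** A collection [(d_ij)], [1 <= j <= i <= n-1], is a triangular array whose
    i-th row is [:: d_i1; ...; d_ii]; entries outside the triangle read as 0,
    so that [d_nj = 0], matching [W_n = W (x) O]. *)
Definition entry (D : seq (seq nat)) (i j : nat) : nat :=
  crd (nth [::] ([::] :: D) i) j.

Definition is_fixpt (D : seq (seq nat)) : bool :=
  (shape D == iota 1 n.-1) &&
  [forall i : 'I_n, forall k : 'I_n, forall j : 'I_n,
     (1 <= j <= k)%N && (k <= i)%N ==> (entry D i j <= entry D k j)%N].

Definition fixpt := {D : seq (seq nat) | is_fixpt D}.
HB.instance Definition _ := Choice.on fixpt.

Definition fdeg (D : fixpt) : degree :=
  [tuple (\sum_(1 <= j < k.+2) entry (val D) k.+1 j)%N | k < n.-1].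

Lemma vac_subproof : is_fixpt [seq nseq k 0%N | k <- iota 1 n.-1].
Proof.
apply/andP; split.
  rewrite /shape -map_comp; apply/eqP; rewrite -[RHS]map_id.
  by apply: eq_map => k /=; rewrite size_nseq.
have e0 i j : entry [seq nseq k 0%N | k <- iota 1 n.-1] i j = 0%N.
  rewrite /entry /crd; case: i => [|i] /=; first by case: j => [|[|j]].
  have [lt_i|le_i] := ltnP i n.-1; last first.
    by rewrite (@nth_default _ [::]) ?size_map ?size_iota //; case: j => [|[|j]].
  rewrite (nth_map 0%N) ?size_iota //; case: j => [|j] //=.
  by rewrite nth_nseq if_same.
by apply/forallP=> i; apply/forallP=> k; apply/forallP=> j; rewrite !e0 implybT.
Qed.

Definition vac : fixpt := Sub _ vac_subproof.

(** [(D, D')] is a fixed point of the correspondence [E_{d,i}], [d] being the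
    degree of [D]. *)
Definition in_corr (i : nat) (D D' : fixpt) : Prop :=
  [/\ fdeg D' = deg_incr (fdeg D) i,
      forall k j, k != i -> entry (val D') k j = entry (val D) k j
    & forall j, (entry (val D) i j <= entry (val D') i j)%N].

End Combinatorics.

(** * Tangent spaces at the fixed points

    The fixed flag is [W_k = sum_(j <= k) z^(d_kj) O w_j].  A tangent vector of
    the space of based flags is a family of [phi_k : W_k -> (W (x) O) / W_k],
    [1 <= k <= n-1], vanishing at infinity, such that [phi_l] restricted to
    [W_k] agrees with [phi_k] modulo [W_l] for [k < l].  The summand
    [(j, m, s)] of a Hom-space is the set of homomorphisms
    [z^a w_j |-> c z^(a - s) w_m] with [c] a scalar; it is of dimension at most
    one, and, [z] having character [v^-2] and [w_i] having character [t_i^2],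
    the torus acts on it by [t_m^2 t_j^-2 v^(2 s)].  Tangent vectors of type
    [(j, m, s)] are thus families of scalars. *)

Section Tangent.
Variables (n : nat) (C : fieldType).
Implicit Types (D : fixpt n) (j m i : nat) (s : int).

(** Whether the [(j, m, s)] summand of [Hom (W_k, (W (x) O) / W'_l) (-oo)] is
    nonzero, where [W] and [W'] are the flags of [D] and [D'].  For [m <= l]
    the target summand is [O / z^(d'_lm)], for [m > l] it is [O], where the
    condition at infinity reads [0 < s]. *)
Definition hom_nonzero D D' (k l j m : nat) s : bool :=
  [&& (1 <= j <= k)%N, s <= (entry (val D) k j)%:Z
    & if (m <= l)%N then (entry (val D) k j)%:Z - s < (entry (val D') l m)%:Z
      else 0 < s].

Definition tanQ_eqs D j m s (c : 'rV[C]_n.-1) : 'rV[C]_n.-1 * 'M[C]_n.-1 :=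
  (\row_k ((~~ hom_nonzero D D k.+1 k.+1 j m s)%:R * c 0 k),
   \matrix_(k, l)
     (((k < l)%N && hom_nonzero D D k.+1 l.+1 j m s)%:R * (c 0 k - c 0 l))).

Definition tanQ D j m s : {vspace 'rV[C]_n.-1} :=
  lker (linfun (tanQ_eqs D j m s)).

(** In the tangent space of the correspondence, [phi_k = phi'_k] for [k <> i],
    and [phi_i], [phi'_i] agree as maps [W'_i -> (W (x) O) / W_i]. *)
Definition tanE_eqs i D D' j m s (c : 'rV[C]_n.-1 * 'rV[C]_n.-1) :
    ('rV[C]_n.-1 * 'M[C]_n.-1) * ('rV[C]_n.-1 * 'M[C]_n.-1) * 'rV[C]_n.-1 :=
  (tanQ_eqs D j m s c.1, tanQ_eqs D' j m s c.2,
   \row_k (((k.+1 != i) || hom_nonzero D' D i i j m s)%:R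
             * (c.1 0 k - c.2 0 k))).

Definition tanE i D D' j m s : {vspace ('rV[C]_n.-1 * 'rV[C]_n.-1)%type} :=
  lker (linfun (tanE_eqs i D D' j m s)).

Lemma tanQ_eqs_linear D j m s : linear (tanQ_eqs D j m s).
Proof.
move=> a c c'; congr pair.
  by apply/rowP=> k; rewrite !mxE mulrDr mulrCA.
apply/matrixP=> k l; rewrite !mxE mulrCA -mulrDr; congr (_ * _).
by rewrite mulrBr opprD addrACA.
Qed.

HB.instance Definition _ D j m s :=
  GRing.isLinear.Build _ _ _ _ (tanQ_eqs D j m s) (tanQ_eqs_linear D j m s).

Lemma tanE_eqs_linear i D D' j m s : linear (tanE_eqs i D D' j m s).
Proof.
move=> a c c'; rewrite /tanE_eqs /= !linearP; congr pair.
apply/rowP=> k; rewrite !mxE mulrCA -mulrDr; congr (_ * _).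
by rewrite mulrBr opprD addrACA.
Qed.

HB.instance Definition _ i D D' j m s :=
  GRing.isLinear.Build _ _ _ _ (tanE_eqs i D D' j m s)
    (tanE_eqs_linear i D D' j m s).

Lemma mem_tanQ D j m s (c : 'rV[C]_n.-1) :
  c \in tanQ D j m s <->
  (forall k : 'I_n.-1, ~~ hom_nonzero D D k.+1 k.+1 j m s -> c 0 k = 0) /\
  (forall k l : 'I_n.-1, (k < l)%N -> hom_nonzero D D k.+1 l.+1 j m s ->
     c 0 k = c 0 l).
Proof.
rewrite memv_ker lfunE /=; split=> [/eqP[/rowP e1 /matrixP e2]|[e1 e2]].
  split=> [k hk|k l lt_kl hkl].
    by move: (e1 k); rewrite !mxE hk mul1r.
  by move: (e2 k l); rewrite !mxE lt_kl hkl mul1r => /eqP; rewrite subr_eq0 => /eqP.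
apply/eqP; congr pair; [apply/rowP=> k | apply/matrixP=> k l]; rewrite !mxE.
  by case: (boolP (hom_nonzero _ _ _ _ _ _ _)) => [_|/e1->]; rewrite ?mul0r ?mulr0.
case: (boolP (_ && _)) => [/andP[lt_kl hkl]|_]; last by rewrite mul0r.
by rewrite (e2 k l) // subrr mulr0.
Qed.

Lemma mem_tanE i D D' j m s (c c' : 'rV[C]_n.-1) :
  (c, c') \in tanE i D D' j m s <->
  [/\ c \in tanQ D j m s, c' \in tanQ D' j m s
    & forall k : 'I_n.-1, (k.+1 != i) || hom_nonzero D' D i i j m s ->
        c 0 k = c' 0 k].
Proof.
rewrite !memv_ker !lfunE /= /tanE_eqs /=; split.
  move=> /eqP e; move: (congr1 (fun x => x.1.1) e) => /= ->.
  move: (congr1 (fun x => x.1.2) e) => /= ->.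
  split=> // k hk; move: (congr1 snd e) => /= /rowP /(_ k).
  by rewrite !mxE hk mul1r => /eqP; rewrite subr_eq0 => /eqP.
case=> /eqP -> /eqP -> e; apply/eqP; congr pair; apply/rowP=> k; rewrite !mxE.
by case: (boolP (_ || _)) => [/e->|_]; rewrite ?subrr ?mulr0 ?mul0r.
Qed.

End Tangent.

(** * Localized equivariant K-theory

    [F] plays the role of Frac C[T x C^*], with coordinates [t 1, ..., t n]
    and [v]. *)

Section KTheory.
Variables (n : nat) (C F : fieldType) (t : nat -> F) (v : F).
Implicit Types (D : fixpt n) (d : degree n) (i j m : nat) (s : int).

(** [prod_chi (1 - chi)^-1] over the weights of a representation whose part of
    type [(j, m, s)] has dimension [mult j m s], nonzero for finitely many [s]
    only (a big operator over [\in] is a product over its support). *)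
Definition sym_char (mult : nat -> nat -> int -> nat) : F :=
  \prod_(1 <= j < n.+1) \prod_(1 <= m < n.+1)
    \big[*%R/1]_(s \in [set: int])
      (1 - t m ^+ 2 * t j ^- 2 * v ^ (2 * s))^-1 ^+ mult j m s.

Definition SchiQ D : F := sym_char (fun j m s => \dim (tanQ C D j m s)).

Definition SchiE i D D' : F :=
  sym_char (fun j m s => \dim (tanE C i D D' j m s)).

(** The character of [Gamma (W_i / W'_i)] *)
Definition lambdaL i D D' : F :=
  \sum_(1 <= j < i.+1)
    \sum_(entry (val D) i j <= c < entry (val D') i j)
      t j ^+ 2 * v ^- (2 * c).

(** The character of [RGamma (Q_d, O)] *)
Definition RGammaQ d : F := \sum_(D \in [set D | fdeg D = d]) SchiQ D.

Definition KM := {malg F[fixpt n]}.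

Definition in_deg d (x : KM) : Prop := forall D, D \in msupp x -> fdeg D = d.

Definition lin_ext (g : fixpt n -> KM) (x : KM) : KM :=
  \sum_(D <- msupp x) x@_D *: g D.

Definition push_p_pull_q i : KM -> KM := lin_ext (fun D' =>
  \sum_(D \in [set D | in_corr i D D'])
    (SchiE i D D' / SchiQ D') *: << D >>).

Definition push_q_L_pull_p i : KM -> KM := lin_ext (fun D =>
  \sum_(D' \in [set D' | in_corr i D D'])
    (lambdaL i D D' * SchiE i D D' / SchiQ D) *: << D' >>).

Local Notation "d `_z k" := ((crd d k)%:Z) (at level 3, k at level 2).

Definition Kval i d : F :=
  t i.+1 / t i * v ^ (2 * d`_z i - d`_z i.-1 - d`_z i.+1 + 1).

(** The operator [K_i ^ a] *)
Definition opK i (a : int) : KM -> KM :=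
  lin_ext (fun D => Kval i (fdeg D) ^ a *: << D >>).

Definition op_f i : KM -> KM := push_p_pull_q i.

Definition op_e i (x : KM) : KM :=
  push_q_L_pull_p i
    (lin_ext (fun D => (- ((t i.+1)^-1 * (t i)^-1
       * v ^ ((fdeg D)`_z i.+1 - (fdeg D)`_z i.-1))) *: << D >>) x).

Definition op_E i (x : KM) : KM := op_e i (opK i (- i%:Z) x).
Definition op_F i (x : KM) : KM := opK i i%:Z (op_f i x).

Record is_shapovalov (B : KM -> KM -> F) : Prop := IsShapovalov {
  shapovalov_sym : forall x y, B x y = B y x;
  shapovalov_linear : forall a x x' y, B (a *: x + x') y = a * B x y + B x' y;
  shapovalov_vac : B << vac n >> << vac n >> = 1;
  shapovalov_EF : forall i, (1 <= i < n)%N ->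
    forall x y, B (op_E i x) y = B x (op_F i y) }.

(** [estar i] is the adjoint of [e_i]. *)
Definition is_e_adjoint (B : KM -> KM -> F) (estar : nat -> KM -> KM) : Prop :=
  forall i, (1 <= i < n)%N -> forall x y, B (op_e i x) y = B x (estar i y).

(** [x], an element of [prod_d M_d], is the Whittaker vector of the operators
    [op i : M_(d+i) -> M_d]. *)
Record is_whittaker (op : nat -> KM -> KM) (x : degree n -> KM) : Prop :=
  IsWhittaker {
  whittaker_deg : forall d, in_deg d (x d);
  whittaker_vac : x (deg0 n) = << vac n >>;
  whittaker_op : forall i, (1 <= i < n)%N ->
    forall d, op i (x (deg_incr d i)) = (1 - v ^+ 2)^-1 *: x d }.

End KTheory.

(** * The field of rational functions on T x C^*

    Eliminating [t_n = (t_1 ... t_(n-1))^-1], it is the field of fractions of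
    [C[t_1, ..., t_(n-1)][v]]. *)

Module Torus.
Import mpoly.

Section Torus.
Variables (R : realType) (n : nat).

Definition ratT : fieldType := {fraction {poly mpoly n.-1 R[i]}}.

Definition vT : ratT := tofrac 'X.

Definition tT0 (k : 'I_n.-1) : ratT := tofrac ('X_k)%:P.

Definition tT (i : nat) : ratT :=
  if insub i.-1 is Some k then tT0 k else (\prod_(k < n.-1) tT0 k)^-1.

End Torus.
End Torus.

Export Torus.

(* Main.v *)
Require Import Defs.
From HB Require Import structures.
From mathcomp Require Import all_boot all_order all_algebra fraction.
From mathcomp Require Import finmap.
From mathcomp Require mpoly.
From mathcomp Require Import classical_sets cardinality fsbigop.
From mathcomp Require Import reals complex monalg.
From mathcomp Require Import zify ring.
(* [monalg] has another [fdeg]. *)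
Import Defs.

(** Let [D'] be obtained from [D] by adding a box in column [p] of row [i], and
    put [s_j = t_j^2 v^(-2 d_ij)] and [r_j = t_j^2 v^(-2 d_(i-1)j)].  Since
    [W_(i-1), W'_i, W_i, W_(i+1)] is again a chain, the tangent space of the
    correspondence at [(D, D')] is that of [Q_d] at [D], plus [v^2], plus the
    [s_p / s_j] with [j <= i], [j <> p], minus the [s_p / r_j] with [j < i].
    Hence [SchiE / SchiQ] is [(1 - v^2)^-1] times the value of
    [prod_j (1 - x / r_j)] at [x = s_p] times a Lagrange coefficient for the
    nodes [s_1, ..., s_i].  Interpolation gives [(1 - v^2)^-1] for the sum over
    [p] (the value at [0]); for the sum weighted by the character [s_p] of the
    line bundle it gives [(1 - v^2)^-1 prod_j s_j / prod_j r_j] (the leading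
    coefficient), which depends on the degree of [D] only.

    So the [sum_D SchiQ(D) [D]] solve the equations of [k], and the equations
    for the numbers [([D], w_d)] have a solution depending on [d] only.  Both
    solutions are unique: a function on the fixed points annihilated by all the
    weighted sums over the ways to add a box vanishes away from [d = 0].  Thus
    nothing about the Shapovalov form is needed beyond the adjunction of
    [e_i]. *)

Set Implicit Arguments.
Unset Strict Implicit.
Unset Printing Implicit Defensive.

Import Order.TTheory GRing.Theory Num.Theory.
Local Open Scope ring_scope.

(** * Fixed points and boxes *)

Section Boxes.
Variable n : nat.
Implicit Types (D : fixpt n) (d : degree n) (i j k p : nat).

Lemma crd_deg_incr d i k : (1 <= k < n)%N ->
  crd (deg_incr d i) k = (crd d k + (k == i))%N.
Proof.
case: k => // k /= lt_kn.
have lt_k : (k < n.-1)%N by lia.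
by rewrite /crd /= -[k in LHS]/(val (Ordinal lt_k)) nth_mktuple.
Qed.

Lemma crd_fdeg D k : (1 <= k < n)%N ->
  crd (fdeg D) k = (\sum_(1 <= j < k.+1) entry (val D) k j)%N.
Proof.
case: k => // k /= lt_kn.
have lt_k : (k < n.-1)%N by lia.
by rewrite /crd /= -[k in LHS]/(val (Ordinal lt_k)) nth_mktuple.
Qed.

Lemma crd_ge d k : (n <= k)%N -> crd d k = 0%N.
Proof.
by case: k => // k le_nk; rewrite /crd nth_default //= size_tuple; lia.
Qed.

Lemma degree_ext d d' : (forall k, (1 <= k < n)%N -> crd d k = crd d' k) -> d = d'.
Proof.
move=> e; apply: eq_from_tnth => k; rewrite !(tnth_nth 0%N).
have lt_k := ltn_ord k; apply: (e k.+1); move: lt_k; lia.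
Qed.

Lemma fixpt_size D : size (val D) = n.-1.
Proof.
by case/andP: (valP D) => /eqP /(congr1 size) + _; rewrite size_map size_iota.
Qed.

Lemma entry_size D i : (1 <= i < n)%N -> size (nth [::] ([::] :: val D) i) = i.
Proof.
case: i => // i /= lt_in; case/andP: (valP D) => /eqP sD _.
by rewrite -nth_shape sD nth_iota; lia.
Qed.

Lemma entry_out D i j : ~~ ((1 <= j <= i) && (i < n))%N -> entry (val D) i j = 0%N.
Proof.
rewrite /entry /crd => out; case: j out => [//|j] out /=.
have [lt_in|le_ni] := ltnP i n; last first.
  case: i le_ni {out} => [|i] le_ni /=; first by rewrite nth_nil.
  by rewrite (@nth_default _ [::]) ?nth_nil // fixpt_size; lia.
case: i out lt_in => [|i] out lt_in /=; first by rewrite nth_nil.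
by rewrite nth_default // (entry_size D (i := i.+1)); lia.
Qed.

Lemma entry_anti D k i j : (1 <= j <= k)%N -> (k <= i)%N ->
  (entry (val D) i j <= entry (val D) k j)%N.
Proof.
move=> jk le_ki; have [lt_in|le_ni] := ltnP i n; last first.
  by rewrite entry_out //; lia.
case/andP: (valP D) => _ /forallP /(_ (Ordinal lt_in)) /forallP.
have lt_kn : (k < n)%N by lia.
move=> /(_ (Ordinal lt_kn)) /forallP.
have lt_jn : (j < n)%N by lia.
by move=> /(_ (Ordinal lt_jn)) /implyP; apply => /=; lia.
Qed.

Lemma fixpt_ext D D' :
  (forall i j, (1 <= j <= i)%N -> (i < n)%N ->
     entry (val D) i j = entry (val D') i j) ->
  D = D'.
Proof.
move=> e; apply: val_inj.
apply: (@eq_from_nth _ [::]); first by rewrite !fixpt_size.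
move=> i; rewrite fixpt_size => lt_i.
have si E := @entry_size E i.+1.
have hi : (1 <= i.+1 < n)%N by lia.
apply: (@eq_from_nth _ 0%N); first by rewrite (si D hi) (si D' hi).
move=> j; rewrite (si D hi) => lt_j.
by apply: (e i.+1 j.+1); lia.
Qed.

(** * Fixed points from entry functions; adding and removing boxes *)

Definition array (f : nat -> nat -> nat) : seq (seq nat) :=
  [seq [seq f k j | j <- iota 1 k] | k <- iota 1 n.-1].

Lemma entry_array f k j : entry (array f) k j =
  if ((1 <= j <= k) && (k < n))%N then f k j else 0%N.
Proof.
rewrite /entry /crd; case: k => [|k] /=.
  by case: j => [|j] //=; rewrite nth_nil.
have [lt_k|le_k] := ltnP k n.-1; last first.
  rewrite (@nth_default _ [::]) ?size_map ?size_iota //.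
  have -> : (k.+1 < n)%N = false by lia.
  by rewrite andbF; case: j => [|j] //=; rewrite nth_nil.
rewrite (nth_map 0%N) ?size_iota // nth_iota //.
case: j => [//|j].
have -> : (k.+1 < n)%N by lia.
rewrite andbT -[nth _ _ _]/(nth _ _ j).
have [lt_j|le_j] := ltnP j.+1 k.+2; last first.
  by rewrite nth_default ?size_map ?size_iota ?ifF //; lia.
rewrite ifT; last by lia.
by rewrite (nth_map 0%N) ?size_iota // nth_iota.
Qed.

Lemma array_fixpt f :
  (forall k i j, (1 <= j <= k)%N -> (k <= i < n)%N -> (f i j <= f k j)%N) ->
  is_fixpt n (array f).
Proof.
move=> anti; apply/andP; split.
  rewrite /shape -map_comp; apply/eqP; rewrite -[RHS]map_id.
  by apply: eq_map => k /=; rewrite size_map size_iota.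
apply/forallP=> i; apply/forallP=> k; apply/forallP=> j; apply/implyP=> h.
have := ltn_ord i; have := ltn_ord k; rewrite !entry_array => hk hi.
by rewrite !ifT; [apply: anti|..]; lia.
Qed.

Definition is_add i p D D' : Prop :=
  forall k j, (1 <= j <= k)%N -> (k < n)%N ->
    entry (val D') k j = (entry (val D) k j + ((k == i) && (j == p)))%N.

(** Column [i] starts in row [i], so for [p = i] no entry above bounds the new one; in the other
    columns the entry above must be strictly larger. *)
Definition addable i p D : bool :=
  (p == i) || (entry (val D) i p < entry (val D) i.-1 p)%N.

Lemma is_add_inj i p D D1 D2 : is_add i p D D1 -> is_add i p D D2 -> D1 = D2.
Proof. by move=> h1 h2; apply: fixpt_ext => k j jk kn; rewrite h1 ?h2. Qed.

Lemma addableP i p D : (1 <= p <= i)%N -> (i < n)%N ->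
  addable i p D <-> exists D', is_add i p D D'.
Proof.
move=> pi lt_in; split=> [ad|[D' hD']]; last first.
  rewrite /addable; case: eqVneq => //= ne_pi.
  have : (entry (val D') i p <= entry (val D') i.-1 p)%N by apply: entry_anti; lia.
  rewrite !hD' ?eqxx; [|lia..]; rewrite (_ : i.-1 == i = false) ?addn0 ?addn1 //; lia.
have F : is_fixpt n (array
    (fun k j => entry (val D) k j + ((k == i) && (j == p)))%N).
  apply: array_fixpt => k l j jk kl.
  have [lt_ln a] : (l < n)%N /\ (entry (val D) l j <= entry (val D) k j)%N.
    by split; [|apply: entry_anti]; lia.
  have [->|nkl] := eqVneq k l; first by [].
  have [el|nl] := eqVneq l i; last by lia.
  have [ej|nj] := eqVneq j p; last by lia.
  rewrite -{}el -{}ej in ad pi lt_in *.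
  have : (entry (val D) l.-1 j <= entry (val D) k j)%N by apply: entry_anti; lia.
  by case/orP: ad => [/eqP|] *; lia.
exists (Sub _ F) => k j jk kn.
by rewrite SubK entry_array ifT //; lia.
Qed.

(** In the last row, [i = n - 1], the entry below reads as 0, so there the condition says that the
    column is nonempty. *)
Lemma removable_ex i p D : (1 <= p <= i)%N -> (i < n)%N ->
  (entry (val D) i.+1 p < entry (val D) i p)%N ->
  exists D', is_add i p D' D.
Proof.
move=> pi lt_in lt_e.
have F : is_fixpt n (array
    (fun k j => entry (val D) k j - ((k == i) && (j == p)))%N).
  apply: array_fixpt => k l j jk kl.
  have [lt_ln a] : (l < n)%N /\ (entry (val D) l j <= entry (val D) k j)%N.
    by split; [|apply: entry_anti]; lia.
  have [->|nkl] := eqVneq k l; first by [].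
  have [ek|nk] := eqVneq k i; last by lia.
  have [ej|nj] := eqVneq j p; last by lia.
  rewrite -{}ek -{}ej in lt_e pi lt_in *.
  have : (entry (val D) l j <= entry (val D) k.+1 j)%N by apply: entry_anti; lia.
  by lia.
exists (Sub _ F) => k j jk kn.
rewrite SubK entry_array ifT; last by lia.
by have [->|_] := eqVneq k i; have [->|_] := eqVneq j p; lia.
Qed.

Lemma is_add_out i p D D' k j : is_add i p D D' -> (1 <= p <= i)%N -> (i < n)%N ->
  entry (val D') k j = (entry (val D) k j + ((k == i) && (j == p)))%N.
Proof.
move=> h pi lt_in; have [b|b] := boolP ((1 <= j <= k) && (k < n))%N.
  by apply: h; lia.
rewrite !entry_out //; case: eqVneq => //= e; case: eqVneq => // e'; lia.
Qed.

Lemma is_add_fdeg i p D D' : (1 <= p <= i)%N -> (i < n)%N -> is_add i p D D' ->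
  fdeg D' = deg_incr (fdeg D) i.
Proof.
move=> pi lt_in h; apply: degree_ext => k hk.
rewrite crd_deg_incr // !crd_fdeg //.
under eq_bigr do rewrite (is_add_out _ _ h) //.
rewrite big_split /=; congr addn.
case: eqVneq => [->|ne] /=; last by rewrite big1.
rewrite (bigD1_seq p) ?iota_uniq ?mem_index_iota //=.
by rewrite eqxx big1 // => j /negPf ->.
Qed.

(** The degrees force the increments along row [i], all nonnegative, to sum to 1; hence exactly one
    column gains a box. *)
Lemma in_corrP i D D' : (1 <= i < n)%N ->
  in_corr i D D' <-> exists2 p, (1 <= p <= i)%N & is_add i p D D'.
Proof.
move=> hi; split=> [[hd hne hle]|[p pi h]]; last first.
  split; first by apply: (is_add_fdeg pi) => //; lia.
    by move=> k j /negPf ki; rewrite (is_add_out _ _ h) ?ki ?addn0 //; lia.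
  by move=> j; rewrite (is_add_out _ _ h) ?leq_addr //; lia.
have es : (\sum_(1 <= j < i.+1) (entry (val D') i j - entry (val D) i j) = 1)%N.
  have := congr1 (fun d : degree n => crd d i) hd.
  rewrite crd_deg_incr // !crd_fdeg // eqxx.
  by rewrite sumnB => [->|j _]; rewrite ?addKn.
have [p pi ep] : exists2 p, (1 <= p <= i)%N &
    (entry (val D') i p - entry (val D) i p != 0)%N.
  have /hasP[p] : has (fun p => entry (val D') i p - entry (val D) i p != 0)%N
      (index_iota 1 i.+1).
    apply/contraT => /hasPn h; move: es; rewrite big1_seq // => j /= /h.
    by rewrite negbK => /eqP.
  by rewrite mem_index_iota => pi ne; exists p => //; lia.
rewrite (bigD1_seq p) ?iota_uniq ?mem_index_iota // in es.
have {es} [e1 e0E] : (entry (val D') i p - entry (val D) i p = 1)%N /\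
    (\sum_(1 <= j < i.+1 | j != p) (entry (val D') i j - entry (val D) i j) = 0)%N.
  by case: (entry _ i p - _)%N ep es => // -[|m] _ [].
exists p => // k j jk kn; have [ek|ne] := eqVneq k i; last by rewrite hne ?addn0.
rewrite {}ek in jk kn *.
have le_j := hle j; have [->|np] := eqVneq j p; first by lia.
suff : (entry (val D') i j - entry (val D) i j = 0)%N by lia.
move/eqP: e0E; rewrite sum_nat_seq_eq0 => /allP /(_ j).
rewrite mem_index_iota np /= => H; apply/eqP/H; lia.
Qed.

Lemma eq_array f g :
  (forall k j, (1 <= j <= k)%N -> (k < n)%N -> f k j = g k j) -> array f = array g.
Proof.
move=> e; apply/eq_in_map => k; rewrite mem_iota => hk.
by apply/eq_in_map => j; rewrite mem_iota => hj; apply: e; lia.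
Qed.

Lemma array_entry D : array (entry (val D)) = val D.
Proof.
have F : is_fixpt n (array (entry (val D))).
  by apply: array_fixpt => k i j jk /andP[ki _]; apply: entry_anti.
rewrite -[LHS](@SubK _ _ (fixpt n) _ F); congr val.
by apply: fixpt_ext => i j ji lt_in; rewrite SubK entry_array ji lt_in.
Qed.

(** [insubd] makes this total: when the enlarged array is not a fixed point the value is the default
    [D]. The filter in [additions] keeps this case out. *)
Definition add_box i p D : fixpt n := insubd D
  (array (fun k j => entry (val D) k j + ((k == i) && (j == p)))%N).

Definition remove_box i p D : fixpt n := insubd D
  (array (fun k j => entry (val D) k j - ((k == i) && (j == p)))%N).

Lemma is_add_box i p D D' : is_add i p D D' -> D' = add_box i p D.
Proof.
move=> ad; rewrite -[LHS](valKd D) -array_entry; congr insubd.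
by apply: eq_array => k j jk kn; apply: ad.
Qed.

Lemma is_remove_box i p D D' : is_add i p D D' -> D = remove_box i p D'.
Proof.
move=> ad; rewrite -[LHS](valKd D') -array_entry; congr insubd.
by apply: eq_array => k j jk kn; rewrite ad // addnK.
Qed.

Lemma add_boxP i p D : (1 <= p <= i)%N -> (i < n)%N -> addable i p D ->
  is_add i p D (add_box i p D).
Proof.
by move=> pi lt_in /(addableP _ pi lt_in)[D' ad]; rewrite -(is_add_box ad).
Qed.

Definition additions i D : seq (fixpt n) :=
  [seq add_box i p D | p <- index_iota 1 i.+1 & addable i p D].

Lemma mem_additions i D D' : (1 <= i < n)%N ->
  D' \in additions i D <-> in_corr i D D'.
Proof.
move=> hi; have lt_in : (i < n)%N by lia.
rewrite in_corrP //; split=> [/mapP[p]|[p pi ad]].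
  rewrite mem_filter mem_index_iota => /andP[ap pi] ->.
  by exists p; [lia|apply: add_boxP => //; lia].
apply/mapP; exists p; last exact: is_add_box.
rewrite mem_filter mem_index_iota; apply/andP; split; last by lia.
by apply/addableP => //; exists D'.
Qed.

Lemma additions_fdeg i D D' : (1 <= i < n)%N -> D' \in additions i D ->
  fdeg D' = deg_incr (fdeg D) i.
Proof. by move=> hi /mem_additions-/(_ hi)[]. Qed.

Lemma additions_uniq i D : (1 <= i < n)%N -> uniq (additions i D).
Proof.
move=> hi; rewrite map_inj_in_uniq ?filter_uniq ?iota_uniq // => p q.
rewrite !mem_filter !mem_index_iota => /andP[ap hp] /andP[aq hq] e.
have h1 : is_add i p D (add_box i p D) by apply: add_boxP => //; lia.
have h2 : is_add i q D (add_box i q D) by apply: add_boxP => //; lia.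
have pi : (1 <= p <= i)%N by lia.
have lt_in : (i < n)%N by lia.
have := h1 i p pi lt_in; rewrite e h2 // !eqxx /=.
by case: eqVneq => // _ /eqP; rewrite eqn_add2l.
Qed.

Lemma sum_additions (V : nmodType) (G : fixpt n -> V) i D : (1 <= i < n)%N ->
  \sum_(D' \in [set D' | in_corr i D D']%classic) G D' =
  \sum_(D' <- additions i D) G D'.
Proof.
move=> hi; rewrite (fsbigE (additions i D)) ?additions_uniq //.
- rewrite big_seq_cond [RHS]big_seq; apply: eq_bigl => D'.
  case: (boolP (D' \in _)) => //= /mem_additions h.
  by rewrite mem_set //; apply: h.
- by move=> D' /= /mem_additions; apply.
- by move=> D' /= h /negP[]; apply/mem_additions.
Qed.

(** [D] is recovered from [D'] by removing a box from one of [i] columns. Finiteness matters because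
    a big operator over a set returns its neutral element when its support is infinite. *)
Lemma finite_removals i D' : (1 <= i < n)%N ->
  finite_set [set D | in_corr i D D']%classic.
Proof.
move=> hi; apply: (@sub_finite_set _ _
  [set` [seq remove_box i p D' | p <- index_iota 1 i.+1]]%classic).
  move=> D /= /in_corrP-/(_ hi)[p pi ad]; apply/mapP.
  exists p; last exact: is_remove_box.
  by rewrite mem_index_iota; lia.
exact: finite_seq.
Qed.

Lemma vacE i j : entry (val (vac n)) i j = 0%N.
Proof.
rewrite /entry /crd /=; case: i => [|i] /=; first by case: j => [|[|j]].
have [lt_i|le_i] := ltnP i n.-1; last first.
  by rewrite (@nth_default _ [::]) ?size_map ?size_iota //; case: j => [|[|j]].
rewrite (nth_map 0%N) ?size_iota //; case: j => [|j] //=.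
by rewrite nth_nseq if_same.
Qed.

Lemma eq_vac D :
  (forall i j, (1 <= j <= i)%N -> (i < n)%N -> entry (val D) i j = 0%N) -> D = vac n.
Proof. by move=> e; apply: fixpt_ext => i j ji lt_in; rewrite vacE e. Qed.

Lemma crd_deg0 k : crd (deg0 n) k = 0%N.
Proof.
case: k => // k; have [lt_k|le_k] := ltnP k n.-1.
  by rewrite /crd /= -[k in LHS]/(val (Ordinal lt_k)) nth_mktuple.
by apply: crd_ge; lia.
Qed.

Lemma fdeg_vac : fdeg (vac n) = deg0 n.
Proof.
apply: degree_ext => k hk; rewrite crd_fdeg // crd_deg0 big1 // => j _.
exact: vacE.
Qed.

Lemma fdeg_eq_deg0 D : fdeg D = deg0 n -> D = vac n.
Proof.
move=> e; apply: eq_vac => i j ji lt_in.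
have hi : (1 <= i < n)%N by lia.
have := crd_fdeg D hi; rewrite e crd_deg0 => /esym/eqP.
rewrite sum_nat_seq_eq0 => /allP /(_ j); rewrite mem_index_iota => H.
by apply/eqP/H; lia.
Qed.

(* By induction on [r], the columns of a fixed point in the support of [xi] are
   constant down to row [r]: otherwise a box of row [r - 1] could be removed,
   and all other ways to add a box back to this row leave the support. *)
Lemma additions_inj (F : fieldType) (xi : fixpt n -> F)
    (c : nat -> fixpt n -> fixpt n -> F) :
  (forall i D D', (1 <= i < n)%N -> D' \in additions i D -> c i D D' != 0) ->
  (forall i D, (1 <= i < n)%N -> \sum_(D' <- additions i D) c i D D' * xi D' = 0) ->
  forall D, D != vac n -> xi D = 0.
Proof.
move=> c_neq0 sum0.
have cols r D : (r.+1 <= n)%N -> xi D != 0 ->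
    forall k j, (1 <= j <= k)%N -> (k <= r.+1)%N ->
      entry (val D) k j = entry (val D) r.+1 j.
  elim: r => [|r IH] in D * => lt_rn xiD k j jk le_k.
    by have -> : k = 1%N by lia.
  have [->//|ne_k] := eqVneq k r.+2.
  rewrite (IH D _ xiD) //; [|lia..].
  apply/eqP/contraT => ne; exfalso.
  have hr : (1 <= r.+1 < n)%N by lia.
  have jr : (1 <= j <= r.+1)%N by lia.
  have lt_e : (entry (val D) r.+2 j < entry (val D) r.+1 j)%N.
    by rewrite ltn_neqAle eq_sym ne entry_anti //; lia.
  have [|D1 ad] := removable_ex jr _ lt_e; first by lia.
  have DD1 : D \in additions r.+1 D1.
    by apply/mem_additions => //; apply/in_corrP => //; exists j.
  have := sum0 r.+1 D1 hr; rewrite (bigD1_seq D) ?additions_uniq //= big1_seq ?addr0.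
    by apply/eqP; rewrite mulf_neq0 // c_neq0.
  move=> D2 /andP[ne2 /mem_additions-/(_ hr) /in_corrP-/(_ hr)[p pr ad2]].
  have ne_pj : p != j.
    by apply: contraNneq ne2 => e; rewrite e in ad2; rewrite (is_add_inj ad2 ad).
  have [->|xiD2] := eqVneq (xi D2) 0; first by rewrite mulr0.
  exfalso; have cst x (E : fixpt n) : (1 <= x < r.+1)%N -> xi E != 0 ->
      entry (val E) r x = entry (val E) r.+1 x.
    by move=> hx xiE; apply: (IH E _ xiE); lia.
  have lt_rn' : (r.+1 < n)%N by lia.
  have E1 k' x := is_add_out k' x ad jr lt_rn'.
  have E2 k' x := is_add_out k' x ad2 pr lt_rn'.
  (* Column [r.+1] has no entry in row [r], so the induction hypothesis says nothing about it. Of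
     the distinct columns [j] and [p], at least one lies to its left; there [D] and [D2] agree in
     row [r], differ in row [r.+1], and cannot both be constant. *)
  have [lt_j|ge_j] := ltnP j r.+1.
    have hj : (1 <= j < r.+1)%N by lia.
    move: (cst j D hj xiD) (cst j D2 hj xiD2).
    by rewrite !E1 !E2 !eqxx; move: ne_pj; clear; lia.
  have hp : (1 <= p < r.+1)%N by lia.
  move: (cst p D hp xiD) (cst p D2 hp xiD2).
  by rewrite !E1 !E2 !eqxx; move: ne_pj; clear; lia.
move=> D; apply: contraNeq => xiD; apply/eqP/eq_vac => i j ji lt_in.
(* Constancy is used down to row [n], where all entries read as 0. *)
have n_gt0 : (n.-1.+1 <= n)%N by lia.
by rewrite (cols _ _ n_gt0 xiD) ?entry_out //; lia.
Qed.

End Boxes.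

(** * Dimensions of the tangent spaces *)

(* Elements of [U] are the functions on a forest vanishing off [v] and constant
   along edges; their values at the roots in [v] are arbitrary. *)
Lemma dim_forest (C : fieldType) (vT : vectType C) (U : {vspace vT})
    (I : finType) (rank : I -> nat) (v : pred I) (nxt : I -> option I)
    (g : vT -> I -> C) :
  (forall a u w x, g (a *: u + w) x = a * g u x + g w x) ->
  (forall x y, nxt x = Some y -> v x /\ (rank y < rank x)%N) ->
  (forall u, u \in U -> forall x, ~~ v x -> g u x = 0) ->
  (forall u, u \in U -> forall x y, nxt x = Some y -> g u x = g u y) ->
  (forall c : I -> C, (forall x, ~~ v x -> c x = 0) ->
     (forall x y, nxt x = Some y -> c x = c y) ->
     exists2 u, u \in U & g u =1 c) ->
  (forall u, u \in U -> (forall x, g u x = 0) -> u = 0) ->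
  (\dim U + \sum_x nxt x = \sum_x v x)%N.
Proof.
move=> glin nxtP gv gn gsurj ginj.
(* The roots of the forest lying in [v]. Evaluation at them is shown to be a bijection from [U] onto
   all functions on [S]. *)
pose S := [pred x | v x && ~~ nxt x].
pose h u : 'rV[C]_#|S| := \row_k g u (enum_val k).
have hlin : linear h.
  by move=> a u w; apply/rowP=> k; rewrite !mxE glin.
pose hL : {linear vT -> 'rV[C]_#|S|} :=
  HB.pack h (GRing.isLinear.Build _ _ _ _ h hlin).
have cap0 : (U :&: lker (linfun hL) = 0)%VS.
  apply/eqP; rewrite -subv0; apply/subvP=> u; rewrite memv_cap => /andP[uU].
  rewrite memv_ker lfunE /= memv0 => /eqP /rowP hu; apply/eqP/ginj => //.
  move=> x; have [r le_r] := ubnP (rank x); elim: r => // r IH in x le_r *.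
  have [vx|/gv->//] := boolP (v x).
  case e: (nxt x) => [y|].
    by rewrite (gn _ uU _ _ e) IH //; have [_] := nxtP _ _ e; move: le_r; lia.
  have xS : x \in S by rewrite inE vx e.
  by have := hu (enum_rank_in xS x); rewrite !mxE enum_rankK_in.
have im : (linfun hL @: U = fullv)%VS.
  apply/eqP; rewrite eqEsubv subvf; apply/subvP=> y _.
  pose val x := \sum_(k < #|S|) y 0 k *+ (enum_val k == x).
  (* Values prescribed at the roots are extended by following the edges. The fuel bounds the length
     of the path; [(rank x).+1] suffices since the rank drops along edges. *)
  pose F := fix F k x := if k is k'.+1 then
     if nxt x is Some y then F k' y else if v x then val x else 0 else 0.
  have FE k : forall k' x, (rank x < k)%N -> (rank x < k')%N -> F k x = F k' x.
    elim: k => // k IH [//|k'] x lt_k lt_k' /=.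
    case e: (nxt x) => [z|//]; have [_ lt_z] := nxtP _ _ e.
    by apply: IH; apply: leq_trans lt_z _.
  pose c x := F (rank x).+1 x.
  have cE x : c x = if nxt x is Some y then c y else if v x then val x else 0.
    rewrite {1}/c -[F _ _]/(if nxt x is Some y then F (rank x) y
                            else if v x then val x else 0).
    by case e: (nxt x) => [z|//]; have [_ lt_z] := nxtP _ _ e; apply: FE.
  have [x nv|x z e|u uU gu] := gsurj c.
  - rewrite cE (negPf nv); case e: (nxt x) => [z|//].
    by have [] := nxtP _ _ e; rewrite (negPf nv).
  - by rewrite cE e.
  suff -> : y = linfun hL u by apply: memv_img.
  rewrite lfunE; apply/rowP=> k; rewrite mxE gu cE.
  have := enum_valP k; rewrite inE => /andP[-> ]; case: (nxt _) => // _.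
  rewrite /val (bigD1 k) //= eqxx big1 ?addr0 // => l ne.
  by rewrite (inj_eq enum_val_inj) (negPf ne).
(* Each vertex has at most one outgoing edge, and edges start in [v]; so the vertices of [v] are the
   roots together with the sources of edges. *)
rewrite -(limg_dim_eq cap0) im dimvf /dim /= mul1n -sum1_card big_mkcond -big_split /=.
apply: eq_bigr => x _; rewrite inE; case e: (nxt x) => [y|] /=; last by case: (v x).
by have [->] := nxtP _ _ e.
Qed.

Lemma sum_pred_succ N (f : nat -> bool) :
  (\sum_(0 <= x < N.-1) f x = \sum_(x < N) ((x.+1 < N) && f x))%N.
Proof.
case: N => [|N]; first by rewrite big_ord0 big_geq.
rewrite big_mkord big_ord_recr /= ltnn addn0.
by apply: eq_bigr => x _; rewrite ltnS ltn_ord.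
Qed.

Lemma sum_pred_pred N (f : nat -> nat -> bool) :
  (\sum_(0 <= x < N.-1) f x x.+1 = \sum_(x < N) ((0 < x)%N && f x.-1 x))%N.
Proof.
case: N => [|N]; first by rewrite big_ord0 big_geq.
by rewrite big_mkord big_ord_recl /= add0n.
Qed.

(** * Compatible families on a chain of flags: vertices minus edges *)

Section Chain.
Variables (N : nat) (rk : nat -> nat) (a : nat -> nat -> nat).
Hypothesis rk_mono : forall x y, (x <= y < N)%N -> (rk x <= rk y)%N.
Hypothesis a_anti : forall x y j, (x <= y < N)%N -> (1 <= j <= rk x)%N ->
  (a y j <= a x j)%N.
Variables (j m : nat) (s : int).
Hypothesis m_gt0 : (0 < m)%N.

(* Whether the [(j, m, s)] summand of [Hom (W_x, W / W_y)] is nonzero, for a chain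
   of flags [W_x = sum_(j <= rk x) z^(a x j) O w_j]; cf. [hom_nonzero]. *)
Definition chain_hom x y : bool :=
  [&& (1 <= j <= rk x)%N, s <= (a x j)%:Z
    & if (m <= rk y)%N then (a x j)%:Z - s < (a y m)%:Z else 0 < s].

Definition chain_map (C : fieldType) (c : nat -> C) : Prop :=
  (forall x, (x < N)%N -> ~~ chain_hom x x -> c x = 0) /\
  (forall x y, (x < y < N)%N -> chain_hom x y -> c x = c y).

Lemma chain_hom_src x y : 0 < s -> (x < y < N)%N -> chain_hom x y -> chain_hom x x.
Proof.
move=> s_gt0 xy /and3P[hj hs hm]; apply/and3P; split=> //.
have rxy : (rk x <= rk y)%N by apply: rk_mono; lia.
case: (leqP m (rk x)) => // mx.
have : (a y m <= a x m)%N by apply: a_anti; lia.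
by move: hm; rewrite ifT; lia.
Qed.

Lemma chain_hom_tgt x y : s <= 0 -> (x < y < N)%N -> chain_hom x y -> chain_hom y y.
Proof.
move=> s_le0 xy /and3P[hj hs hm].
have rxy : (rk x <= rk y)%N by apply: rk_mono; lia.
have axy : (a y j <= a x j)%N by apply: a_anti; lia.
apply/and3P; split; [lia|lia|].
by move: hm; case: ifP; lia.
Qed.

(** For [s > 0] one climbs from [x] towards [y]: the condition at [(x, y)] gives the one at
    [(x, x.+1)], and then either it persists at [(x.+1, y)], or [s] exceeds the exponents at both
    [x.+1] and [y] and both values vanish. For [s <= 0] one descends from the upper end in the same
    way; there the descent stops when [m] exceeds the rank, which again makes both values 0. *)
Lemma chain_map_step (C : fieldType) (c : nat -> C) :
  (forall x, (x < N)%N -> ~~ chain_hom x x -> c x = 0) ->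
  (forall x, (x.+1 < N)%N -> chain_hom x x.+1 -> c x = c x.+1) ->
  chain_map c.
Proof.
move=> c0 c1; split=> // x y; have [s_gt0|s_le0] := ltrP 0 s.
  have [k] := ubnP (y - x); elim: k => // k IH in x * => lt_k xy hxy.
  have rS : (rk x <= rk x.+1)%N by apply: rk_mono; lia.
  have rSy : (rk x.+1 <= rk y)%N by apply: rk_mono; lia.
  case/and3P: hxy => hj hs hm.
  have aS : (a x.+1 j <= a x j)%N by apply: a_anti; lia.
  have aSy : (a y j <= a x.+1 j)%N by apply: a_anti; lia.
  have hS : chain_hom x x.+1.
    apply/and3P; split=> //; case: (leqP m (rk x.+1)) => // mS.
    have : (a y m <= a x.+1 m)%N by apply: a_anti; lia.
    by move: hm; rewrite ifT; lia.
  rewrite c1 //; last by lia.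
  have [-> //|ne] := eqVneq y x.+1.
  have [sS|Ss] := lerP s (a x.+1 j)%:Z; last first.
    by rewrite !c0 //; [lia | | lia |]; rewrite /chain_hom; lia.
  apply: IH; [lia|lia|]; apply/and3P; split; [lia|by []|].
  by move: hm; case: ifP; lia.
elim: y => // y IH xy hxy.
case/and3P: hxy => hj hs hm.
have rxy : (rk x <= rk y)%N by apply: rk_mono; lia.
have ryS : (rk y <= rk y.+1)%N by apply: rk_mono; lia.
have axy : (a y j <= a x j)%N by apply: a_anti; lia.
have hy : chain_hom y y.+1.
  by apply/and3P; split; [lia|lia|move: hm; case: ifP; lia].
rewrite -c1 //; last by lia.
have [-> //|ne] := eqVneq x y.
have [my|ym] := leqP m (rk y); last first.
  by rewrite !c0 //; [lia | | lia |]; rewrite /chain_hom ifN; lia.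
apply: IH; first by lia.
apply/and3P; split=> //; rewrite my.
have : (a y.+1 m <= a y m)%N by apply: a_anti; lia.
by move: hm; rewrite ifT; lia.
Qed.

(* For [s > 0] an edge starts at a vertex with nonzero [Hom], for [s <= 0] it ends
   at one, so that the chain is a forest rooted at the top, resp. at the bottom. *)
Lemma dim_chain (C : fieldType) (vT : vectType C) (U : {vspace vT})
    (g : vT -> nat -> C) :
  (forall b u w x, g (b *: u + w) x = b * g u x + g w x) ->
  (forall u, u \in U -> chain_map (g u)) ->
  (forall c, chain_map c -> exists2 u, u \in U & forall x, (x < N)%N -> g u x = c x) ->
  (forall u, u \in U -> (forall x, (x < N)%N -> g u x = 0) -> u = 0) ->
  (\dim U + \sum_(0 <= x < N.-1) chain_hom x x.+1 = \sum_(0 <= x < N) chain_hom x x)%N.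
Proof.
move=> glin gU gsurj ginj.
pose g' u (x : 'I_N) := g u x.
have out0 (c : 'I_N -> C) (x : 'I_N) :
    (if insub (x : nat) is Some z then c z else 0) = c x.
  by rewrite valK.
have [s_gt0|s_le0] := ltrP 0 s.
  pose nxt (x : 'I_N) : option 'I_N := if chain_hom x x.+1 then insub x.+1 else None.
  have nxtE x y : nxt x = Some y -> chain_hom x x.+1 /\ y = x.+1 :> nat.
    by rewrite /nxt; case: ifP => // h; case: insubP => // z _ <- [->].
  have -> : (\sum_(0 <= x < N.-1) chain_hom x x.+1 = \sum_x nxt x)%N.
    rewrite sum_pred_succ; apply: eq_bigr => x _; rewrite /nxt.
    by case: ifP => [h|_]; rewrite ?andbF // andbT; case: insubP => [z ->|/negPf ->].
  rewrite [RHS]big_mkord; apply: (@dim_forest _ _ U _ (fun x : 'I_N => N - x)%N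
             (fun x => chain_hom x x) nxt g') => //.
  - by move=> *; apply: glin.
  - move=> x y /nxtE[h e]; split; last by have := ltn_ord y; lia.
    by apply: chain_hom_src h; have := ltn_ord y; lia.
  - by move=> u /gU[h _] x; apply: h.
  - move=> u /gU[_ h] x y /nxtE[hx e]; rewrite /g' (h x y) ?e //.
    by have := ltn_ord y; lia.
  - move=> c c0 c1.
    have [|u uU gu] := gsurj (fun x => if insub x is Some z then c z else 0).
      apply: chain_map_step => x lt_x.
        by move=> hx; rewrite insubT; apply: c0.
      move=> hx; have lt_x' : (x < N)%N by lia.
      by rewrite !insubT; apply: c1; rewrite /nxt /= hx insubT.
    by exists u => // x; rewrite /g' gu // out0.
  - move=> u uU h; apply: ginj => // x lt_x; exact: (h (Ordinal lt_x)).
pose nxt (x : 'I_N) : option 'I_N :=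
  if (0 < x)%N && chain_hom x.-1 x then insub x.-1 else None.
have nxtE x y : nxt x = Some y -> chain_hom y x /\ x = y.+1 :> nat.
  rewrite /nxt; case: ifP => // /andP[h1 h2]; case: insubP => // z _ e [<-].
  by rewrite e; split => //; lia.
have -> : (\sum_(0 <= x < N.-1) chain_hom x x.+1 = \sum_x nxt x)%N.
  rewrite sum_pred_pred; apply: eq_bigr => x _; rewrite /nxt.
  case: x => -[|x] //= lt_x; case: ifP => // _.
  by rewrite insubT //; lia.
rewrite [RHS]big_mkord; apply: (@dim_forest _ _ U _ (fun x : 'I_N => x : nat)
           (fun x => chain_hom x x) nxt g') => //.
- by move=> *; apply: glin.
- move=> x y /nxtE[h e]; split; last by rewrite e.
  by apply: chain_hom_tgt h => //; have := ltn_ord x; lia.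
- by move=> u /gU[h _] x; apply: h.
- move=> u /gU[_ h] x y /nxtE[hx e]; rewrite /g' (h y x) //.
  by have := ltn_ord x; lia.
- move=> c c0 c1.
  have [|u uU gu] := gsurj (fun x => if insub x is Some z then c z else 0).
    apply: chain_map_step => x lt_x.
      by move=> hx; rewrite insubT; apply: c0.
    move=> hx; have lt_x' : (x < N)%N by lia.
    by rewrite !insubT; apply/esym/c1; rewrite /nxt /= hx insubT.
  by exists u => // x; rewrite /g' gu // out0.
- move=> u uU h; apply: ginj => // x lt_x; exact: (h (Ordinal lt_x)).
Qed.

End Chain.

(** * Tangent spaces as compatible families on chains *)

Section TangentDim.
Variables (n : nat) (C : fieldType).
Implicit Types (D : fixpt n).

(** Moves the 0-based coordinates to the flag indices [1, ..., n-1]. Index 0 stands for the flag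
    member [W_0 = 0] and carries the value 0. *)
Definition row_coord (c : 'rV[C]_n.-1) (x : nat) : C :=
  if x is x'.+1 then if insub x' is Some k then c 0 k else 0 else 0.

Lemma row_coord_linear b c c' x :
  row_coord (b *: c + c') x = b * row_coord c x + row_coord c' x.
Proof.
case: x => [|x] /=; first by rewrite mulr0 addr0.
by case: insub => [k|]; rewrite ?mxE ?mulr0 ?addr0.
Qed.

Lemma row_coord_ord c (k : 'I_n.-1) : row_coord c k.+1 = c 0 k.
Proof. by rewrite /= valK. Qed.

Lemma row_coordK (f : nat -> C) x : (0 < x < n)%N ->
  row_coord (\row_k f k.+1) x = f x.
Proof.
case: x => // x /= h; have lt_x : (x < n.-1)%N by lia.
by rewrite insubT mxE.
Qed.

Lemma row_coord_inj c c' :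
  (forall x, (0 < x < n)%N -> row_coord c x = row_coord c' x) -> c = c'.
Proof.
move=> e; apply/rowP=> k; rewrite -!row_coord_ord; apply: e.
by have := ltn_ord k; lia.
Qed.

(** The chain is [W_0, ..., W_(n-1)] with [W_x] of rank [x]. Including [W_0 = 0] imposes nothing, as
    no [j] satisfies [1 <= j <= 0]; it provides the vertex preceding row 1, so that [i = 1] is no
    special case later. *)
Lemma mem_tanQ_chain D j m s c :
  c \in tanQ C D j m s <-> chain_map n id (entry (val D)) j m s (row_coord c).
Proof.
split=> [/mem_tanQ[c0 c1]|[c0 c1]]; last first.
  apply/mem_tanQ; split=> [k hk|k l kl hk]; rewrite -!row_coord_ord.
    by apply: c0 hk; have := ltn_ord k; lia.
  by apply: c1 hk; have := ltn_ord l; lia.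
split=> [[|x] lt_x //= hx|[|x] [|y] // xy h].
  by case: insubP => // k _ e; apply: c0; rewrite e.
  by case/and3P: h => /= h _ _; lia.
have lt_x : (x < n.-1)%N by lia.
have lt_y : (y < n.-1)%N by lia.
rewrite /= !insubT; apply: (c1 (Ordinal lt_x) (Ordinal lt_y)) => //=; lia.
Qed.

Lemma mem_tanE_chain i D D' j m s c c' : (1 <= i < n)%N ->
  (c, c') \in tanE C i D D' j m s <->
  [/\ chain_map n id (entry (val D)) j m s (row_coord c),
      chain_map n id (entry (val D')) j m s (row_coord c')
    & forall x, (0 < x < n)%N -> (x != i) || hom_nonzero D' D i i j m s ->
        row_coord c x = row_coord c' x].
Proof.
move=> hi; split=> [/mem_tanE[/mem_tanQ_chain h1 /mem_tanQ_chain h2 h3]|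
                    [/mem_tanQ_chain h1 /mem_tanQ_chain h2 h3]].
  split=> // -[//|x] hx hxi; have lt_x : (x < n.-1)%N by lia.
  by rewrite /= !insubT; apply: h3.
apply/mem_tanE; split=> // k hk; rewrite -!row_coord_ord; apply: h3 => //.
by have := ltn_ord k; lia.
Qed.

Lemma dim_tanQ D j m s : (0 < n)%N -> (0 < m)%N ->
  (\dim (tanQ C D j m s) + \sum_(0 <= x < n.-1) hom_nonzero D D x x.+1 j m s
   = \sum_(0 <= x < n) hom_nonzero D D x x j m s)%N.
Proof.
move=> n_gt0 m_gt0.
apply: (@dim_chain n id (entry (val D)) _ _ j m s m_gt0 _ _ _ row_coord).
- by move=> x y; lia.
- by move=> x y k xy hk; apply: entry_anti; lia.
- exact: row_coord_linear.
- by move=> c /mem_tanQ_chain.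
- move=> c hc; have c00 : c 0%N = 0.
    by apply: hc.1 => //; apply/negP => /and3P[h _ _]; lia.
  have cE x : (x < n)%N -> row_coord (\row_k c k.+1) x = c x.
    by case: x => [//|x] hx; apply: row_coordK.
  exists (\row_k c k.+1) => //; apply/mem_tanQ_chain; split=> [x lt_x /hc.1|x y xy h].
    by rewrite cE //; apply.
  by rewrite !cE; [exact: hc.2|lia..].
- move=> c _ h; apply: row_coord_inj => x hx; rewrite h; last by lia.
  by case: x {hx} => //= x; case: insub => // k; rewrite mxE.
Qed.

(** A tangent vector of the correspondence is a compatible family on the chain with both [W'_i] and
    [W_i], which has [n.+1] members. The sums are the vertices and edges of that chain, rewritten in
    terms of [D] wherever row [i] of [D'] is not involved. *)
Lemma dim_tanE_chain i p D D' j m s : (1 <= p <= i)%N -> (i < n)%N -> (0 < m)%N ->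
  is_add i p D D' ->
  (\dim (tanE C i D D' j m s)
    + (\sum_(0 <= x < i.-1) hom_nonzero D D x x.+1 j m s
       + hom_nonzero D D' i.-1 i j m s + hom_nonzero D' D i i j m s
       + \sum_(i <= x < n.-1) hom_nonzero D D x x.+1 j m s)
   = \sum_(0 <= x < i) hom_nonzero D D x x j m s
      + hom_nonzero D' D' i i j m s
      + \sum_(i <= x < n) hom_nonzero D D x x j m s)%N.
Proof.
move=> pi lt_in m_gt0 ad.
have eD' k l : entry (val D') k l = (entry (val D) k l + ((k == i) && (l == p)))%N.
  by apply: is_add_out.
have eD'n k l : k != i -> entry (val D') k l = entry (val D) k l.
  by move=> /negPf ki; rewrite eD' ki addn0.
(* The chain follows [D'] through row [i] and [D] from row [i] on. Rank [i] occurs twice, at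
   positions [i] and [i.+1], and positions beyond [i] are shifted by one. *)
pose rk x := if (x <= i)%N then x else x.-1.
pose a x := if (x <= i)%N then entry (val D') x else entry (val D) x.-1.
pose g (u : 'rV[C]_n.-1 * 'rV[C]_n.-1) x :=
  if (x <= i)%N then row_coord u.2 x else row_coord u.1 x.-1.
pose hom x y := chain_hom rk a j m s x y.
have hom_ll x y : (x <= i)%N -> (y <= i)%N -> hom x y = hom_nonzero D' D' x y j m s.
  by move=> xi yi; rewrite /hom /chain_hom /rk /a xi yi.
have hom_lr x y : (x <= i)%N -> (i < y)%N -> hom x y = hom_nonzero D' D x y.-1 j m s.
  by move=> xi yi; rewrite /hom /chain_hom /rk /a xi (leqNgt y) yi.
have hom_rr x y : (i < x)%N -> (i < y)%N -> hom x y = hom_nonzero D D x.-1 y.-1 j m s.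
  by move=> xi yi; rewrite /hom /chain_hom /rk /a (leqNgt x) (leqNgt y) xi yi.
have hom'E x y k l : x != i -> y != i ->
    hom_nonzero D' D' x y k l s = hom_nonzero D D x y k l s.
  by move=> xi yi; rewrite /hom_nonzero !eD'n.
have dimE : (\dim (tanE C i D D' j m s) + \sum_(0 <= x < n) hom x x.+1
             = \sum_(0 <= x < n.+1) hom x x)%N.
  apply: (@dim_chain n.+1 rk a _ _ j m s m_gt0 _ _ (tanE C i D D' j m s) g).
  - by move=> x y; rewrite /rk; case: ifP; case: ifP; lia.
  - move=> x y k xy; rewrite /rk /a; case: (leqP x i) => xi hk; case: (leqP y i) => yi.
    + by apply: entry_anti; lia.
    + apply: (@leq_trans (entry (val D') y.-1 k)); first by rewrite eD' leq_addr.
      by apply: entry_anti; lia.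
    + by lia.
    + by apply: entry_anti; lia.
  - move=> b [u1 u2] [w1 w2] x; rewrite /g /=.
    by case: ifP => _; apply: row_coord_linear.
  - move=> [c c'] /mem_tanE_chain [|[c0 c1] [c0' c1'] lnk]; first by lia.
    split=> [x lt_x|x y xy]; rewrite -/(hom _ _) /g /=.
      case: (leqP x i) => xi; first by rewrite hom_ll // => hx; apply: c0' => //; lia.
      by rewrite hom_rr // => hx; apply: c0 => //; lia.
    case: (leqP x i) => xi; case: (leqP y i) => yi.
    + by rewrite hom_ll // => h; apply: c1' => //; lia.
    (* An edge from the [D'] part to the [D] part. The equalities of [c] and [c'] off row [i] move
       it into [D'] if its upper row is not [i], and into [D] if its lower row is not [i]; the edge
       from [W'_i] to [W_i] is the remaining condition of [tanE]. *)
    + rewrite hom_lr //; have [ey|ne] := eqVneq y.-1 i; last first.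
        move=> h; rewrite lnk ?ne //; last by lia.
        by apply: c1' => //; [lia|rewrite /chain_hom (eD'n y.-1)].
      rewrite ey; have [->|nx] := eqVneq x i.
        by move=> h; rewrite lnk ?h ?orbT //; lia.
      move=> h; have x_gt0 : (0 < x)%N by case/and3P: h; lia.
      rewrite -lnk ?nx //; last by lia.
      by apply: c1 => //; [lia|move: h; rewrite /chain_hom /hom_nonzero (eD'n x)].
    + by lia.
    + by rewrite hom_rr // => h; apply: c1 => //; lia.
  - move=> c [c0 c1].
    have cE (f : nat -> nat) x : (0 < x < n)%N ->
        row_coord (\row_k c (f k.+1)) x = c (f x).
      exact: (@row_coordK (fun x => c (f x))).
    have c00 : c 0%N = 0.
      by apply: c0 => //; apply/negP => /and3P[]; rewrite /rk leq0n; lia.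
    have z0 (f : nat -> nat) : f 0%N = 0%N -> forall x, (x < n)%N ->
        row_coord (\row_k c (f k.+1)) x = c (f x).
      by move=> f0 [|x] hx; [rewrite f0 c00|apply: cE].
    (* The positions in the chain of row [x] of [D] and, for [f2], of row [x] of [D']; they coincide
       except at [x = i]. *)
    pose f1 x := if (x < i)%N then x else x.+1.
    pose f2 x := if (x <= i)%N then x else x.+1.
    have f10 : f1 0%N = 0%N by rewrite /f1 ifT //; lia.
    have f20 : f2 0%N = 0%N by [].
    exists (\row_k c (f1 k.+1), \row_k c (f2 k.+1)).
      apply/mem_tanE_chain; first by lia.
      split.
      + split=> [x lt_x|x y xy] h; rewrite !z0 //; try lia.
          apply: c0; first by rewrite /f1; case: ifP; lia.
          rewrite -/(hom _ _) /f1; case: (ltnP x i) => xi.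
            by rewrite hom_ll ?hom'E //; lia.
          by rewrite hom_rr //; lia.
        apply: c1; first by rewrite /f1; do 2 case: ifP; lia.
        rewrite -/(hom _ _) /f1; case: (ltnP x i) => xi; case: (ltnP y i) => yi.
        * by rewrite hom_ll ?hom'E //; lia.
        * by rewrite hom_lr /hom_nonzero ?eD'n //; lia.
        * by lia.
        * by rewrite hom_rr //; lia.
      + split=> [x lt_x|x y xy] h; rewrite !z0 //; try lia.
          apply: c0; first by rewrite /f2; case: ifP; lia.
          rewrite -/(hom _ _) /f2; case: (leqP x i) => xi.
            by rewrite hom_ll.
          by rewrite hom_rr -?hom'E //; lia.
        apply: c1; first by rewrite /f2; do 2 case: ifP; lia.
        rewrite -/(hom _ _) /f2; case: (leqP x i) => xi; case: (leqP y i) => yi.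
        * by rewrite hom_ll.
        * by rewrite hom_lr ?succnK /hom_nonzero -?(eD'n y) //; lia.
        * by lia.
        * by rewrite hom_rr ?succnK -?hom'E //; lia.
      + move=> x hx; rewrite !z0 //; try lia.
        have [->|ne] /= := eqVneq x i; last first.
          by move=> _; rewrite /f1 /f2; congr c; do 2 case: ifP; lia.
        move=> h; rewrite /f1 /f2 ltnn leqnn; apply/esym/c1; first by lia.
        by rewrite -/(hom _ _) hom_lr.
    move=> x lt_x; rewrite /g /=; case: (leqP x i) => xi; rewrite z0 //; try lia.
      by rewrite /f2 xi.
    by rewrite /f1; congr c; case: ifP; lia.
  - move=> [c c'] /mem_tanE_chain [|[c0 c1] [c0' c1'] lnk]; first by lia.
    move=> h.
    have c'i x : (0 < x <= i)%N -> row_coord c' x = 0.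
      by move=> hx; have := h x; rewrite /g /= ifT; [apply|]; lia.
    have ci x : (i <= x < n)%N -> row_coord c x = 0.
      by move=> hx; have := h x.+1; rewrite /g /= ifF; [apply|]; lia.
    have z0 x : row_coord 0 x = 0 :> C.
      by case: x => //= x; case: insub => // k; rewrite mxE.
    congr pair; apply: row_coord_inj => x hx; rewrite z0.
      have [le_ix|lt_xi] := leqP i x; first by apply: ci; lia.
      by rewrite lnk ?ltn_eqF //; apply: c'i; lia.
    have [le_xi|lt_ix] := leqP x i; first by apply: c'i; lia.
    by rewrite -lnk ?gtn_eqF //; apply: ci; lia.
have vert : (\sum_(0 <= x < n.+1) hom x x = \sum_(0 <= x < i) hom_nonzero D D x x j m s
      + hom_nonzero D' D' i i j m s
      + \sum_(i <= x < n) hom_nonzero D D x x j m s)%N.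
  rewrite (big_cat_nat (n := i)) //=; last by lia.
  rewrite (big_ltn (m := i)); last by lia.
  rewrite big_add1 /= hom_ll //. rewrite addnA; congr (_ + _ + _)%N.
    by apply: eq_big_nat => x hx; rewrite hom_ll ?hom'E //; lia.
  by apply: eq_big_nat => x hx; rewrite hom_rr //; lia.
have edge : (\sum_(0 <= x < n) hom x x.+1 =
       \sum_(0 <= x < i.-1) hom_nonzero D D x x.+1 j m s
       + hom_nonzero D D' i.-1 i j m s + hom_nonzero D' D i i j m s
       + \sum_(i <= x < n.-1) hom_nonzero D D x x.+1 j m s)%N.
  rewrite (big_cat_nat (n := i.-1)) //=; last by lia.
  rewrite (big_ltn (m := i.-1)); last by lia.
  rewrite prednK; last by lia.
  rewrite (big_ltn (m := i)); last by lia.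
  rewrite big_add1 hom_ll ?hom_lr //=; last by lia.
  rewrite -!addnA; congr (_ + (_ + (_ + _)))%N.
  - by apply: eq_big_nat => x hx; rewrite hom_ll ?hom'E //; lia.
  - by rewrite /hom_nonzero eD'n //; lia.
  - by apply: eq_big_nat => x hx; rewrite hom_rr //; lia.
by rewrite -edge -vert.
Qed.

End TangentDim.

(** * Comparison of the two tangent spaces; finiteness of the set of weights *)

Section EulerDim.
Variables (n : nat) (C : fieldType).
Implicit Types (D : fixpt n).

(** Replacing [W_i] by [W'_i] in the target enlarges the quotient by the line [W_i / W'_i] in column
    [p]. So the two vertex-minus-edge counts differ by the homomorphisms into this line, from [W'_i]
    (a vertex) and from [W_(i-1)] (an edge). Terms are kept on the side where they are added, to
    avoid truncated subtraction. *)
Lemma dim_tanE i p D D' j m s : (1 <= p <= i)%N -> (i < n)%N -> (0 < m)%N ->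
  is_add i p D D' ->
  (\dim (tanE C i D D' j m s)
    + [&& m == p, (1 <= j < i)%N
        & s == ((entry (val D) i.-1 j)%:Z - (entry (val D) i p)%:Z)%R]
   = \dim (tanQ C D j m s)
    + [&& m == p, (1 <= j <= i)%N
        & s == ((entry (val D) i j + (j == p))%N%:Z - (entry (val D) i p)%:Z)%R])%N.
Proof.
move=> pi lt_in m_gt0 ad.
have eD' k l : entry (val D') k l = (entry (val D) k l + ((k == i) && (l == p)))%N.
  by apply: is_add_out.
have dimE := dim_tanE_chain C j s pi lt_in m_gt0 ad.
have dimQ := dim_tanQ C D j s (leq_ltn_trans (leq0n i) lt_in) m_gt0.
rewrite (big_cat_nat (n := i.-1)) //= in dimQ; last by lia.
rewrite (big_ltn (m := i.-1)) in dimQ; last by lia.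
rewrite prednK in dimQ; last by lia.
rewrite [RHS in _ = RHS](big_cat_nat (n := i)) //= in dimQ; last by lia.
have e1 : (hom_nonzero D' D' i i j m s = hom_nonzero D' D i i j m s +
     [&& m == p, (1 <= j <= i)%N
        & s == ((entry (val D) i j + (j == p))%N%:Z - (entry (val D) i p)%:Z)%R] :> nat)%N.
  rewrite /hom_nonzero !eD' eqxx !andTb.
  have [->|ne] := eqVneq m p; last by rewrite !andFb !addn0.
  rewrite !ifT; [|lia..].
  rewrite !andTb addn1; case: (1 <= j <= i)%N => //=.
  by move: (_ + (j == p))%N (entry _ i p) => x y; lia.
have e2 : (hom_nonzero D D' i.-1 i j m s = hom_nonzero D D i.-1 i j m s +
     [&& m == p, (1 <= j < i)%N
        & s == ((entry (val D) i.-1 j)%:Z - (entry (val D) i p)%:Z)%R]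
     :> nat)%N.
  rewrite /hom_nonzero !eD' eqxx !andTb.
  have [->|ne] := eqVneq m p; last by rewrite !andFb !addn0.
  rewrite !ifT; [|lia..].
  rewrite !andTb addn1 (_ : (1 <= j <= i.-1) = (1 <= j < i))%N; last by lia.
  case: (1 <= j < i)%N => //=.
  by move: (entry _ i.-1 _) (entry _ i p) => x y; lia.
rewrite {}e1 {}e2 in dimE; move: dimE dimQ; clear.
set X := nat_of_bool [&& m == p, (1 <= j < i)%N & _].
set Y := nat_of_bool [&& m == p, (1 <= j <= i)%N & _].
by move: X Y (\dim (tanE _ _ _ _ _ _ _)) (\dim (tanQ _ _ _ _ _)); lia.
Qed.

Lemma tanQ_support D j m : (0 < m)%N ->
  exists r : seq int, forall s, \dim (tanQ C D j m s) != 0%N -> s \in r.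
Proof.
move=> m_gt0.
pose L := (\sum_(0 <= x < n) (entry (val D) x j + entry (val D) x m))%N.
(* The integers from [-L] to [L]: a nonzero summand at row [x] has [s] at most the entry in column
   [j] and more than minus the entry in column [m]. *)
exists [seq k%:Z - L%:Z | k <- iota 0 L.*2.+1].
move=> s ne.
have n_gt0 : (0 < n)%N.
  have [n0|//] := posnP n; case/negP: ne; rewrite -leqn0.
  by rewrite (leq_trans (dimvS (subvf _))) // dimvf /dim /= mul1n n0.
have := dim_tanQ C D j s n_gt0 m_gt0.
have [/hasP[x]|/hasPn h] :=
  boolP (has (fun x => hom_nonzero D D x x j m s) (index_iota 0 n)); last first.
  rewrite [RHS]big1_seq => [/eqP|x /andP[_ /h /negPf -> //]].
  by rewrite addn_eq0 (negPf ne).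
rewrite mem_index_iota => xn /and3P[hj hs hm] _.
have le1 : (entry (val D) x m <= L)%N.
  by rewrite /L (bigD1_seq x) ?mem_index_iota ?iota_uniq //=; lia.
have le2 : (entry (val D) x m + entry (val D) x j <= L)%N.
  by rewrite /L (bigD1_seq x) ?mem_index_iota ?iota_uniq //=; lia.
move: L le1 le2 => L le1 le2; apply/mapP; exists (absz (s + L%:Z)).
  rewrite mem_iota.
  by move: hm; case: ifP; lia.
by move: hm; case: ifP; lia.
Qed.

End EulerDim.

(** * Lagrange interpolation *)

Section Lagrange.
Variables (F : fieldType) (I : eqType) (r : seq I) (x : I -> F).
Hypothesis r_uniq : uniq r.
Hypothesis x_inj : {in r &, injective x}.

Lemma size_prod_linear (a b : I -> F) (P : pred I) (s : seq I) :
  (size (\prod_(j <- s | P j) ((a j)%:P + b j *: 'X))%R <= (count P s).+1)%N.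
Proof.
elim: s => [|j s IH]; first by rewrite big_nil size_poly1.
rewrite big_cons /=; case: (P j) => //=.
apply: leq_trans (size_polyMleq _ _) _.
have : (size ((a j)%:P + b j *: 'X)%R <= 2)%N.
  rewrite (leq_trans (size_polyD _ _)) // geq_max size_polyC.
  rewrite (leq_trans (size_scale_leq _ _)) ?size_polyX //.
  by case: (_ != 0).
move=> le2; apply: (@leq_trans (2 + (count P s).+1).-1); last by rewrite addSn.
by rewrite -!subn1 leq_sub2r // leq_add.
Qed.

(** The index is the number of factors, so this is the coefficient in the top possible degree even
    when some [b j] vanish. *)
Lemma coef_prod_linear (a b : I -> F) (P : pred I) (s : seq I) :
  (\prod_(j <- s | P j) ((a j)%:P + b j *: 'X))`_(count P s) = \prod_(j <- s | P j) b j.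
Proof.
elim: s => [|j s IH]; first by rewrite !big_nil coef1.
rewrite !big_cons /=; case: (P j) => //=.
rewrite mulrDl -scalerAl coefD coefCM coefZ coefXM /= IH.
by rewrite nth_default ?mulr0 ?add0r // size_prod_linear.
Qed.

(** The difference of the two sides has too many roots for its size. The basis polynomials are
    products of factors [a + b X], so that both the value at 0 and the top coefficient can be read
    off. *)
Lemma lagrange_interpolation (p : {poly F}) : (size p <= size r)%N ->
  p = \sum_(i <- r) p.[x i] *:
        \prod_(j <- r | j != i) ((x j / (x j - x i))%:P + (x i - x j)^-1 *: 'X).
Proof.
move=> size_p; apply/eqP; rewrite -subr_eq0; apply/eqP.
have size_r i : i \in r -> (count (predC1 i) r).+1 = size r.
  by move=> ir; rewrite -(count_predC (pred1 i) r) count_uniq_mem // ir.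
apply: (@roots_geq_poly_eq0 _ _ (map x r)); last first.
- rewrite size_map (leq_trans (size_polyD _ _)) // size_polyN geq_max size_p big_seq.
  apply: (big_ind (fun q : {poly F} => size q <= size r)%N) => [|q1 q2 h1 h2|i ir].
  + by rewrite size_poly0.
  + by rewrite (leq_trans (size_polyD _ _)) // geq_max h1.
  + by rewrite (leq_trans (size_scale_leq _ _)) // -(size_r i ir) size_prod_linear.
- by rewrite map_inj_in_uniq.
apply/allP=> _ /mapP[k kr ->]; rewrite rootE !hornerE horner_sum.
rewrite (bigD1_seq k) //= [X in - (_ + X)]big1_seq ?addr0 => [|i /andP[ne ir]].
  rewrite hornerZ horner_prod big1_seq ?mulr1 ?subrr // => j /andP[ne jr].
  have ne_x : x k - x j != 0 by rewrite subr_eq0 (inj_in_eq x_inj) // eq_sym.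
  by rewrite !hornerE; field; rewrite ne_x -opprB oppr_eq0.
rewrite hornerZ horner_prod big_mkcond (bigD1_seq k) //= eq_sym ne !hornerE.
by rewrite -(opprB (x k)) invrN mulNr [_^-1 * _]mulrC subrr /= mulr0 mul0r.
Qed.

Lemma lagrange_horner0 (p : {poly F}) : (size p <= size r)%N ->
  \sum_(i <- r) p.[x i] * \prod_(j <- r | j != i) (x j / (x j - x i)) = p.[0].
Proof.
move=> size_p; rewrite [in RHS](lagrange_interpolation size_p) horner_sum.
apply: eq_bigr => i _; rewrite hornerZ horner_prod; congr (_ * _).
by apply: eq_bigr => j _; rewrite !hornerE /= ?mulr0 ?addr0.
Qed.

Lemma lagrange_lead (p : {poly F}) : (size p <= size r)%N ->
  \sum_(i <- r) p.[x i] * \prod_(j <- r | j != i) (x i - x j)^-1 = p`_(size r).-1.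
Proof.
move=> size_p; rewrite [in RHS](lagrange_interpolation size_p) coef_sum.
rewrite big_seq [RHS]big_seq.
apply: eq_bigr => i ir; rewrite coefZ; congr (_ * _).
have <- : count (predC1 i) r = (size r).-1.
  by rewrite -(count_predC (pred1 i) r) count_uniq_mem // ir.
by rewrite coef_prod_linear.
Qed.

End Lagrange.

(** * The correspondences *)

Section SymChar.
Variables (n : nat) (F : fieldType) (t : nat -> F) (v : F).
Implicit Types (mult : nat -> nat -> int -> nat).

(** The condition under which the product over all integers [s] in [sym_char] is a genuine finite
    product, hence multiplicative in [mult]. *)
Definition finite_mult mult : Prop := forall j m, (0 < m)%N ->
  exists r : seq int, forall s, mult j m s != 0%N -> s \in r.

Lemma fsbig_seqE (G : int -> F) (r : seq int) : uniq r ->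
  (forall s, s \notin r -> G s = 1) ->
  \big[*%R/1]_(s \in [set: int]) G s = \prod_(s <- r) G s.
Proof. move=> ur G1; rewrite (fsbigE r) // => [|s _ /G1 //].
by apply: eq_bigl => s; rewrite in_setT.
Qed.

Lemma sym_charD mult1 mult2 : finite_mult mult1 -> finite_mult mult2 ->
  sym_char n t v (fun j m s => mult1 j m s + mult2 j m s)%N =
  sym_char n t v mult1 * sym_char n t v mult2.
Proof.
move=> fin1 fin2; rewrite -big_split; apply: eq_big_nat => j hj /=.
rewrite -big_split; apply: eq_big_nat => m /andP[m_gt0 _] /=.
have [r1 h1] := fin1 j m m_gt0; have [r2 h2] := fin2 j m m_gt0.
pose r := undup (r1 ++ r2).
have out s : s \notin r -> mult1 j m s = 0%N /\ mult2 j m s = 0%N.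
  rewrite mem_undup mem_cat negb_or => /andP[s1 s2].
  by split; apply/eqP; [apply: contraNT s1 => /h1|apply: contraNT s2 => /h2].
rewrite !(@fsbig_seqE _ r) ?undup_uniq //;
  try by move=> s /out[e1 e2]; rewrite ?e1 ?e2 expr0.
by rewrite -big_split; apply: eq_bigr => s _; rewrite exprD.
Qed.

Lemma eq_sym_char mult1 mult2 :
  (forall j m s, (0 < m)%N -> mult1 j m s = mult2 j m s) ->
  sym_char n t v mult1 = sym_char n t v mult2.
Proof.
move=> e; apply: eq_big_nat => j hj; apply: eq_big_nat => m /andP[m_gt0 _].
by apply: eq_fsbigr => s _; rewrite e.
Qed.

Lemma finite_mult_line p q (sigma : nat -> int) :
  finite_mult (fun j m s => [&& m == p, (1 <= j < q)%N & s == sigma j] : nat).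
Proof.
move=> j m _; exists [:: sigma j] => s.
by rewrite eqb0 negbK inE => /and3P[].
Qed.

Lemma sym_char_line p q (sigma : nat -> int) : (1 <= p <= n)%N -> (q <= n.+1)%N ->
  sym_char n t v (fun j m s => [&& m == p, (1 <= j < q)%N & s == sigma j] : nat) =
  \prod_(1 <= j < q) (1 - t p ^+ 2 * t j ^- 2 * v ^ (2 * sigma j))^-1.
Proof.
move=> hp hq.
transitivity (\prod_(1 <= j < n.+1)
   if (j < q)%N then (1 - t p ^+ 2 * t j ^- 2 * v ^ (2 * sigma j))^-1 else 1).
  apply: eq_big_nat => j /andP[j_gt0 _].
  rewrite (bigD1_seq p) ?iota_uniq ?mem_index_iota //=.
  rewrite [X in _ * X]big1 ?mulr1 => [|m /negPf ne]; last first.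
    by apply: fsbig1 => s _; rewrite ne.
  rewrite (@fsbig_seqE _ [:: sigma j]) // => [|s].
    by rewrite big_seq1 !eqxx j_gt0 andbT /=; case: ifP.
  by rewrite inE => /negPf ->; rewrite !andbF.
have [q_gt0|q0] := posnP q; first by rewrite q_gt0 [RHS]big_geq // big1.
rewrite (big_cat_nat (n := q)) //= [X in _ * X]big1_seq ?mulr1.
  by apply: eq_big_nat => j /andP[_ ->].
by move=> j; rewrite mem_index_iota => /andP[_ /andP[le_qj _]]; rewrite ltnNge le_qj.
Qed.

Hypothesis generic : forall j m s, (1 <= j <= n)%N -> (1 <= m <= n)%N ->
  t m ^+ 2 * t j ^- 2 * v ^ (2 * s) = 1 -> m = j /\ s = 0.

(** A factor [1 - chi] vanishes only for the trivial character, which is of type [(j, j, 0)] by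
    [generic]. *)
Lemma sym_char_neq0 mult : (forall j, (0 < j)%N -> mult j j 0 = 0%N) ->
  sym_char n t v mult != 0.
Proof.
move=> diag0; rewrite prodf_seq_neq0; apply/allP=> j.
rewrite mem_index_iota => hj; rewrite implyTb prodf_seq_neq0; apply/allP=> m.
rewrite mem_index_iota => hm; rewrite implyTb prodf_seq_neq0; apply/allP=> s _.
rewrite implyTb; have [e|ne] := eqVneq (t m ^+ 2 * t j ^- 2 * v ^ (2 * s)) 1.
  have [-> ->] := generic hj hm e.
  by rewrite diag0 ?expr0 ?oner_eq0 //; case/andP: hj.
by rewrite expf_neq0 // invr_eq0 subr_eq0 eq_sym.
Qed.

End SymChar.

(** * The ratio [SchiE / SchiQ] and its sums over the columns of a row *)

Section Coefficients.
Variables (n : nat) (C F : fieldType) (t : nat -> F) (v : F).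
Hypothesis generic : forall j m s, (1 <= j <= n)%N -> (1 <= m <= n)%N ->
  t m ^+ 2 * t j ^- 2 * v ^ (2 * s) = 1 -> m = j /\ s = 0.
Hypothesis t_neq0 : forall j, (1 <= j <= n)%N -> t j != 0.
Hypothesis v_neq0 : v != 0.
Implicit Types (D : fixpt n).

(* The character of the box added in column [j] of row [i]. *)
Definition sp D i j : F := t j ^+ 2 * v ^ (- (2 * (entry (val D) i j)%:Z)).

Lemma sp_neq0 D i j : (1 <= j <= n)%N -> sp D i j != 0.
Proof. by move=> hj; rewrite mulf_neq0 ?expf_neq0 ?expfz_neq0 // t_neq0. Qed.

Lemma sp_ratio D i p k j : (1 <= j <= n)%N ->
  t p ^+ 2 * t j ^- 2 * v ^ (2 * ((entry (val D) k j)%:Z - (entry (val D) i p)%:Z)) =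
  sp D i p / sp D k j.
Proof.
move=> hj; rewrite /sp mulrBr expfzDr // (invfM (t j ^+ 2)) invr_expz opprK [RHS]mulrACA.
by congr (_ * _); rewrite mulrC.
Qed.

Lemma sp_eq1 D i p k j : (1 <= j <= n)%N -> (1 <= p <= n)%N ->
  sp D i p / sp D k j = 1 -> p = j /\ entry (val D) k j = entry (val D) i p.
Proof.
move=> hj hp; rewrite -sp_ratio // => /generic[//|//|-> e]; split=> //.
by apply/eqP; rewrite -eqz_nat -subr_eq0 e.
Qed.

Lemma subr1_v2_neq0 : (0 < n)%N -> 1 - v ^+ 2 != 0.
Proof.
move=> n_gt0; apply/negP; rewrite subr_eq0 eq_sym => /eqP e.
have h1 : (1 <= 1 <= n)%N by [].
have [] // := generic (s := 1) h1 h1.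
by rewrite mulr1 -[v ^ 2]/(v ^+ 2) e mulr1 mulfV // expf_neq0 // t_neq0.
Qed.

Lemma lambdaL_add i p D D' : (1 <= p <= i)%N -> (i < n)%N -> is_add i p D D' ->
  lambdaL t v i D D' = sp D i p.
Proof.
move=> pi lt_in ad; rewrite /lambdaL (bigD1_seq p) ?iota_uniq ?mem_index_iota //=.
rewrite [X in _ + X]big1 => [|j ne]; last first.
  by rewrite (is_add_out _ _ ad) // (negPf ne) andbF addn0 big_geq.
rewrite (is_add_out _ _ ad) // !eqxx addn1 big_nat1 /= addr0 /sp.
by rewrite exprnN PoszM.
Qed.

(* The value of [SchiE / SchiQ] at the addition of a box in column [p]; it
   vanishes when the box cannot be added. *)
Definition add_coef i p D : F :=
  (1 - v ^+ 2)^-1 * \prod_(1 <= j < i) (1 - sp D i p / sp D i.-1 j)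
  * \prod_(1 <= j < i.+1 | j != p) (1 - sp D i p / sp D i j)^-1.

(** The trivial weight does not occur in the tangent space: the fixed points are isolated. *)
Lemma tanQ_diag D j : (0 < n)%N -> (0 < j)%N -> \dim (tanQ C D j j 0) = 0%N.
Proof.
move=> n_gt0 j_gt0; have := dim_tanQ C D j 0 n_gt0 j_gt0.
rewrite [RHS]big1 => [/eqP|x _]; first by rewrite addn_eq0 => /andP[/eqP].
by apply/eqP; rewrite eqb0; apply/negP => /and3P[/andP[_ ->]] _; lia.
Qed.

Lemma SchiQ_neq0 D : (0 < n)%N -> SchiQ C t v D != 0.
Proof. by move=> n_gt0; apply: sym_char_neq0 => // j j_gt0; apply: tanQ_diag. Qed.

Lemma SchiE_neq0 i p D D' : (1 <= p <= i)%N -> (i < n)%N -> is_add i p D D' ->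
  SchiE C t v i D D' != 0.
Proof.
move=> pi lt_in ad; apply: sym_char_neq0 => // j j_gt0.
have n_gt0 : (0 < n)%N by apply: leq_ltn_trans lt_in.
have := dim_tanE C j 0 pi lt_in j_gt0 ad; rewrite tanQ_diag // add0n.
set b := (X in _ = X); suff -> : b = 0%N by move/eqP; rewrite addn_eq0 => /andP[/eqP].
apply/eqP; rewrite eqb0; have [->|//] := eqVneq j p.
by apply/negP => /andP[_ /andP[_ /eqP]]; lia.
Qed.

Lemma SchiE_add i p D D' : (1 <= p <= i)%N -> (i < n)%N -> is_add i p D D' ->
  SchiE C t v i D D' = SchiQ C t v D * add_coef i p D.
Proof.
move=> pi lt_in ad.
have n_gt0 : (0 < n)%N by apply: leq_ltn_trans lt_in.
pose X j := (entry (val D) i.-1 j)%:Z - (entry (val D) i p)%:Z.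
pose Y j := (entry (val D) i j + (j == p))%N%:Z - (entry (val D) i p)%:Z.
have finQ : finite_mult (fun j m s => \dim (tanQ C D j m s)).
  by move=> j m; apply: tanQ_support.
have finE : finite_mult (fun j m s => \dim (tanE C i D D' j m s)).
  move=> j m m_gt0; have [r hr] := tanQ_support C D j m_gt0.
  exists (Y j :: r) => s; have := dim_tanE C j s pi lt_in m_gt0 ad.
  rewrite inE; have [->//|ne] := eqVneq s (Y j).
  rewrite !andbF addn0 => e h; apply: hr; move: e h.
  by case: (\dim (tanQ _ _ _ _ _)) => // /eqP; rewrite addn_eq0 => /andP[/eqP->].
have E := @eq_sym_char n F t v
  (fun j m s => (\dim (tanE C i D D' j m s) + [&& m == p, 1 <= j < i & s == X j])%N)
  (fun j m s => (\dim (tanQ C D j m s) + [&& m == p, 1 <= j < i.+1 & s == Y j])%N)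
  (fun j m s m_gt0 => dim_tanE C j s pi lt_in m_gt0 ad).
rewrite !sym_charD // in E; try exact: finite_mult_line.
rewrite !(@sym_char_line n _ t v p) // in E; try lia.
have hp : (1 <= p <= n)%N by lia.
have hj j : (1 <= j < i.+1)%N -> (1 <= j <= n)%N by lia.
have EX : \prod_(1 <= j < i) (1 - t p ^+ 2 * t j ^- 2 * v ^ (2 * X j))^-1 =
          (\prod_(1 <= j < i) (1 - sp D i p / sp D i.-1 j))^-1.
  rewrite -prodfV; apply: eq_big_nat => j /andP[h1 h2].
  by rewrite sp_ratio //; lia.
have EY : \prod_(1 <= j < i.+1) (1 - t p ^+ 2 * t j ^- 2 * v ^ (2 * Y j))^-1 =
          (1 - v ^+ 2)^-1 * \prod_(1 <= j < i.+1 | j != p) (1 - sp D i p / sp D i j)^-1.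
  rewrite (bigD1_seq p) ?iota_uniq ?mem_index_iota //=; congr (_ * _).
    (* In column [p] the source is [W'_i], one box longer than [W_i]; this shift by 1 produces the
       weight [v^2]. *)
    have -> : Y p = 1 by rewrite /Y eqxx; lia.
    rewrite mulr1.
    by rewrite mulfV ?mul1r // expf_neq0 // t_neq0.
  rewrite big_seq_cond [RHS]big_seq_cond; apply: eq_bigr => j.
  rewrite mem_index_iota => /andP[/hj h /negPf ne].
  by rewrite /Y ne addn0 sp_ratio.
rewrite EX EY in E.
rewrite /add_coef -/(SchiE _ _ _ _ _ _) -/(SchiQ _ _ _ _).
move: E; rewrite -/(SchiE _ _ _ _ _ _) -/(SchiQ _ _ _ _) => E.
(* By genericity a factor vanishes only for [j = p] with equal entries in rows [i.-1] and [i], and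
   then no box could be added in column [p]. *)
have nz : \prod_(1 <= j < i) (1 - sp D i p / sp D i.-1 j) != 0.
  rewrite prodf_seq_neq0; apply/allP=> j; rewrite mem_index_iota => jr.
  rewrite implyTb subr_eq0 eq_sym; apply/eqP => /sp_eq1[||ep e]; try lia.
  rewrite -{}ep in e jr.
  have /addableP : exists D', is_add i p D D' by exists D'.
  by move=> /(_ pi lt_in); rewrite /addable; lia.
move/(canRL (mulfVK nz)): E => ->; ring.
Qed.

(** The numerator contains the factor [j = p], which is 0. Sums over possible additions may
    therefore run over all columns, that is, over all interpolation nodes. *)
Lemma add_coef_not_addable i p D : (1 <= p <= i)%N -> (i < n)%N ->
  ~~ addable i p D -> add_coef i p D = 0.
Proof.
move=> pi lt_in; rewrite negb_or -leqNgt => /andP[ne le_e].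
have e : entry (val D) i.-1 p = entry (val D) i p.
  by apply/eqP; rewrite eqn_leq le_e entry_anti //; lia.
rewrite /add_coef (bigD1_seq p) ?iota_uniq ?mem_index_iota //=; last by lia.
by rewrite {2}/sp e mulfV ?subrr ?mul0r ?mulr0 ?mul0r // sp_neq0 //; lia.
Qed.

Lemma add_coef_lagrange i p D : (1 <= p <= i)%N -> (i < n)%N ->
  add_coef i p D = (1 - v ^+ 2)^-1 *
    ((\prod_(1 <= j < i) (1%:P + - (sp D i.-1 j)^-1 *: 'X)).[sp D i p]
     * \prod_(1 <= j < i.+1 | j != p) (sp D i j / (sp D i j - sp D i p))).
Proof.
move=> pi lt_in; rewrite /add_coef -mulrA; congr (_ * (_ * _)).
  rewrite horner_prod; apply: eq_bigr => j _.
  by rewrite hornerD hornerC hornerZ hornerX mulNr [_^-1 * _]mulrC.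
rewrite big_seq_cond [RHS]big_seq_cond; apply: eq_bigr => j.
rewrite mem_index_iota => /andP[hj ne].
have nz : sp D i j != 0 by rewrite sp_neq0 //; lia.
by rewrite -[1 in LHS](mulfV nz) -mulrBl invfM invrK mulrC.
Qed.

Lemma sp_inj i D : (i < n)%N -> {in index_iota 1 i.+1 &, injective (sp D i)}.
Proof.
move=> lt_in j k; rewrite !mem_index_iota => hj hk e.
have [] // := @sp_eq1 D i j i k; [lia|lia|].
by rewrite e mulfV // sp_neq0 //; lia.
Qed.

Lemma size_numerator i D : (0 < i)%N ->
  (size (\prod_(1 <= j < i) (1%:P + - (sp D i.-1 j)^-1 *: 'X))%R
    <= size (index_iota 1 i.+1))%N.
Proof.
move=> i_gt0; rewrite (leq_trans (size_prod_linear _ _ _ _)) // count_predT !size_iota; lia.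
Qed.

Lemma sum_add_coef i D : (0 < i < n)%N ->
  \sum_(1 <= p < i.+1) add_coef i p D = (1 - v ^+ 2)^-1.
Proof.
case/andP=> i_gt0 lt_in.
under eq_big_nat => p hp do rewrite (add_coef_lagrange D hp lt_in).
rewrite -mulr_sumr.
rewrite (lagrange_horner0 (iota_uniq _ _) (@sp_inj i D lt_in) (size_numerator D i_gt0)).
rewrite horner_prod big1 ?mulr1 // => j _.
by rewrite hornerD hornerC hornerZ hornerX mulr0 addr0.
Qed.

Lemma sum_add_coef_sp i D : (0 < i < n)%N ->
  \sum_(1 <= p < i.+1) sp D i p * add_coef i p D =
  (1 - v ^+ 2)^-1 * (\prod_(1 <= j < i.+1) sp D i j / \prod_(1 <= j < i) sp D i.-1 j).
Proof.
case/andP=> i_gt0 lt_in.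
have L := lagrange_lead (iota_uniq _ _) (@sp_inj i D lt_in) (size_numerator D i_gt0).
have cnt : (size (index_iota 1 i.+1)).-1 = count predT (index_iota 1 i).
  by rewrite count_predT !size_iota; lia.
rewrite {}cnt coef_prod_linear in L.
have prodN (x : nat -> F) b :
    \prod_(1 <= j < b) - x j = (-1) ^+ b.-1 * \prod_(1 <= j < b) x j.
  rewrite -(subn1 b) -prodr_const_nat -big_split.
  by apply: eq_bigr => j _ /=; rewrite mulN1r.
(* The weight [sp D i p] supplies the node missing from the Lagrange numerators, so the product of
   all nodes comes out of the sum; the signs come from reversing the differences in the
   denominators. *)
transitivity (\sum_(1 <= p < i.+1) (1 - v ^+ 2)^-1 * (- \prod_(1 <= j < i.+1) - sp D i j) *
  ((\prod_(1 <= j < i) (1%:P + - (sp D i.-1 j)^-1 *: 'X)).[sp D i p]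
     * \prod_(1 <= j < i.+1 | j != p) (sp D i p - sp D i j)^-1)).
  apply: eq_big_nat => p hp; rewrite (add_coef_lagrange D hp lt_in).
  rewrite [in RHS](bigD1_seq p) ?iota_uniq ?mem_index_iota //=.
  have -> : \prod_(1 <= j < i.+1 | j != p) (sp D i j / (sp D i j - sp D i p)) =
      \prod_(1 <= j < i.+1 | j != p) - sp D i j *
      \prod_(1 <= j < i.+1 | j != p) (sp D i p - sp D i j)^-1.
    rewrite -big_split; apply: eq_bigr => j _ /=.
    by rewrite -[sp D i j - _]opprB invrN mulrN mulNr.
  by ring.
rewrite -mulr_sumr L !prodN -mulrA; congr (_ * _).
case: i {lt_in L} i_gt0 => // i _ /=.
rewrite prodfV exprS mulN1r mulNr opprK mulrACA -expr2 sqrr_sign mul1r //.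
Qed.

End Coefficients.

(** * Coefficients of linear extensions, and bilinear expansions *)

Section LinExt.
Variables (n : nat) (F : fieldType).
Implicit Types (D : fixpt n) (x : KM n F).

Lemma lin_ext_scale (g : fixpt n -> KM n F) a D : lin_ext g (a *: << D >>) = a *: g D.
Proof.
rewrite /lin_ext msuppZ; have [->|ne] := eqVneq a 0; first by rewrite big_nil scale0r.
by rewrite msuppU oner_eq0 big_seq_fset1 mcoeffZ mcoeffUU mulr1.
Qed.

Lemma mcoeff_fsbig (S : set (fixpt n)) (c : fixpt n -> F) D : finite_set S ->
  (\sum_(D' \in S) c D' *: << D' >> : KM n F)@_D = if D \in S then c D else 0.
Proof.
move=> finS; rewrite fsbig_finite // raddf_sum /=.
case: ifPn => [DS|DS]; last first.
  rewrite big1_seq // => D' /andP[_]; rewrite in_fset_set // => D'S.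
  rewrite mcoeffZ mcoeffU; case: eqVneq D'S DS => [->->//|_ _ _]; exact: mulr0.
rewrite (bigD1_seq D) ?fset_uniq ?in_fset_set //= big1 ?addr0 => [|D' /negPf ne].
  by rewrite mcoeffZ mcoeffUU mulr1.
by rewrite mcoeffZ mcoeffU ne mulr0.
Qed.

(** Trades the varying support of [x] for a fixed list: both sides reduce to the common elements, as
    coefficients outside the support are 0. *)
Lemma sum_msupp x (r : seq (fixpt n)) (c : fixpt n -> F) : uniq r ->
  \sum_(D <- msupp x) x@_D * (if D \in r then c D else 0) = \sum_(D <- r) x@_D * c D.
Proof.
move=> ur; transitivity (\sum_(D <- msupp x | D \in r) x@_D * c D).
  by rewrite [RHS]big_mkcond; apply: eq_bigr => D _; case: ifP; rewrite ?mulr0.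
transitivity (\sum_(D <- r | D \in msupp x) x@_D * c D).
  rewrite -big_filter -[RHS]big_filter; apply: perm_big.
  apply: uniq_perm; rewrite ?filter_uniq ?fset_uniq // => D.
  by rewrite !mem_filter andbC.
rewrite [LHS]big_mkcond; apply: eq_bigr => D _; case: ifPn => // /mcoeff_outdom ->.
by rewrite mul0r.
Qed.

Variable B : KM n F -> KM n F -> F.
Hypothesis B_sym : forall x y, B x y = B y x.
Hypothesis B_linear : forall a x x' y, B (a *: x + x') y = a * B x y + B x' y.

Lemma pairing0l y : B 0 y = 0.
Proof.
have := B_linear 1 0 0 y; rewrite scaler0 addr0 mul1r => /eqP.
by rewrite -subr_eq subrr eq_sym => /eqP.
Qed.

Lemma pairingZl a x y : B (a *: x) y = a * B x y.
Proof. by have := B_linear a x 0 y; rewrite addr0 pairing0l addr0. Qed.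

Lemma pairingZr a x y : B x (a *: y) = a * B x y.
Proof. by rewrite B_sym pairingZl B_sym. Qed.

Lemma pairing_suml (I : Type) (r : seq I) (c : I -> F) (X : I -> KM n F) y :
  B (\sum_(i <- r) c i *: X i) y = \sum_(i <- r) c i * B (X i) y.
Proof.
elim: r => [|i r IH]; first by rewrite !big_nil pairing0l.
by rewrite !big_cons B_linear IH.
Qed.

Lemma pairing_msupp x y : B x y = \sum_(D <- msupp x) x@_D * B << D >> y.
Proof.
rewrite {1}[x]monalgE -pairing_suml; congr (B _ y); apply: eq_bigr => D _.
apply/malgP => D'; rewrite [LHS]mcoeffU [RHS]mcoeffZ mcoeffU.
by case: eqP; rewrite ?mulr1 ?mulr0.
Qed.

End LinExt.

(** * Sums over the fixed points of a correspondence *)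

Section Whittaker.
Variables (n : nat) (C F : fieldType) (t : nat -> F) (v : F).
Hypothesis n_gt0 : (0 < n)%N.
Hypothesis generic : forall j m s, (1 <= j <= n)%N -> (1 <= m <= n)%N ->
  t m ^+ 2 * t j ^- 2 * v ^ (2 * s) = 1 -> m = j /\ s = 0.
Hypothesis t_neq0 : forall j, (1 <= j <= n)%N -> t j != 0.
Hypothesis v_neq0 : v != 0.
Implicit Types (D : fixpt n) (d : degree n).

Lemma sum_additions_coef (G : fixpt n -> F) (phi : nat -> F) i D : (1 <= i < n)%N ->
  (forall p D', (1 <= p <= i)%N -> is_add i p D D' ->
     G D' = phi p * add_coef t v i p D) ->
  \sum_(D' <- additions i D) G D' = \sum_(1 <= p < i.+1) phi p * add_coef t v i p D.
Proof.
move=> hi GE; have lt_in : (i < n)%N by lia.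
rewrite big_map big_filter big_mkcond; apply: eq_big_nat => p hp.
case: ifPn => ap; last by rewrite (add_coef_not_addable t_neq0) ?mulr0 //; lia.
by apply: GE => //; apply: add_boxP => //; lia.
Qed.

Lemma sum_SchiE i D : (1 <= i < n)%N ->
  \sum_(D' <- additions i D) SchiE C t v i D D' = (1 - v ^+ 2)^-1 * SchiQ C t v D.
Proof.
move=> hi; rewrite (@sum_additions_coef _ (fun=> SchiQ C t v D)) //.
  by rewrite -mulr_sumr (sum_add_coef generic) // mulrC.
by move=> p D' pi ad; apply: SchiE_add ad => //; lia.
Qed.

Lemma prod_sp D i : (i < n)%N ->
  \prod_(1 <= j < i.+1) sp t v D i j =
  (\prod_(1 <= j < i.+1) t j ^+ 2) * v ^ (- (2 * (crd (fdeg D) i)%:Z)).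
Proof.
move=> lt_in; rewrite big_split /=; congr (_ * _).
case: (posnP i) => [->|i_gt0]; first by rewrite big_geq // /crd /= mulr0 oppr0 expr0z.
rewrite crd_fdeg; last by lia.
(* Only the bounds on the columns are generalized; the row of the entries stays [i]. *)
elim: {1 3}i => [|k IH].
  by rewrite !big_geq // mulr0 oppr0 expr0z.
rewrite big_nat_recr //= IH [in RHS]big_nat_recr //= -expfzDr // PoszD.
by congr (v ^ _); rewrite mulrDr opprD.
Qed.

(** By [prod_sp] the factors [t_j^2] with [j < i] cancel between rows [i] and [i.-1], and the rest
    depends on [D] through its degree alone. *)
Lemma sum_lambda_SchiE i D : (1 <= i < n)%N ->
  \sum_(D' <- additions i D) lambdaL t v i D D' * SchiE C t v i D D' / SchiQ C t v D =
  (1 - v ^+ 2)^-1 * (t i ^+ 2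
    * v ^ (2 * ((crd (fdeg D) i.-1)%:Z - (crd (fdeg D) i)%:Z))).
Proof.
move=> hi; rewrite (@sum_additions_coef _ (sp t v D i)) //; last first.
  move=> p D' pi ad; have lt_in : (i < n)%N by lia.
  rewrite (lambdaL_add _ _ pi lt_in ad) (SchiE_add C generic t_neq0 v_neq0 pi lt_in ad) //.
  by field; rewrite (SchiQ_neq0 C generic).
rewrite (sum_add_coef_sp generic) //; congr (_ * _).
case: i hi => // i hi; rewrite prod_sp; last by lia.
rewrite prod_sp; last by lia.
rewrite big_nat_recr //=.
have nz : \prod_(1 <= j < i.+1) t j ^+ 2 != 0.
  rewrite prodf_seq_neq0; apply/allP=> j; rewrite mem_index_iota => hj.
  by rewrite implyTb expf_neq0 // t_neq0 //; lia.
rewrite mulrBr expfzDr // -!invr_expz.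
by field; rewrite nz !expfz_neq0.
Qed.

(** All entries vanish, so a nonzero summand would need both [s <= 0] and [0 < s]: the tangent space
    is zero. *)
Lemma SchiQ_vac : SchiQ C t v (vac n) = 1.
Proof.
apply: big1_seq => j /andP[_]; rewrite mem_index_iota => /andP[j_gt0 _].
apply: big1_seq => m /andP[_]; rewrite mem_index_iota => /andP[m_gt0 _].
apply: fsbig1 => s _; suff -> : \dim (tanQ C (vac n) j m s) = 0%N by [].
have := dim_tanQ C (vac n) j s n_gt0 m_gt0; rewrite [RHS]big1 => [/eqP|x _].
  by rewrite addn_eq0 => /andP[/eqP].
apply/eqP; rewrite eqb0; apply/negP => /and3P[_]; rewrite !vacE; case: ifP; lia.
Qed.

End Whittaker.

(** * The Whittaker vectors *)

Section Pairing.
Local Arguments crd : simpl never.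
Variables (n : nat) (C F : fieldType) (t : nat -> F) (v : F).
Hypothesis n_gt0 : (0 < n)%N.
Hypothesis generic : forall j m s, (1 <= j <= n)%N -> (1 <= m <= n)%N ->
  t m ^+ 2 * t j ^- 2 * v ^ (2 * s) = 1 -> m = j /\ s = 0.
Hypothesis t_neq0 : forall j, (1 <= j <= n)%N -> t j != 0.
Hypothesis v_neq0 : v != 0.
Implicit Types (D : fixpt n) (d : degree n) (x : KM n F).

(** Read at one coefficient, [f_i] becomes a weighted sum over additions to [D], the shape required
    by [additions_inj]. *)
Lemma mcoeff_op_f i x D : (1 <= i < n)%N ->
  (op_f C t v i x)@_D =
  \sum_(D' <- additions i D) x@_D' * (SchiE C t v i D D' / SchiQ C t v D').
Proof.
move=> hi; rewrite /op_f /push_p_pull_q /lin_ext raddf_sum /=.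
rewrite -sum_msupp ?additions_uniq //; apply: eq_bigr => D' _.
rewrite mcoeffZ mcoeff_fsbig; last exact: finite_removals.
congr (_ * _); have [h|h] := boolP (D' \in additions i D).
  by rewrite mem_set //; apply/mem_additions.
by rewrite memNset // => /mem_additions-/(_ hi); apply/negP.
Qed.

Definition e_scalar i d : F := - ((t i.+1)^-1 * (t i)^-1
  * v ^ ((crd d i.+1)%:Z - (crd d i.-1)%:Z)).

Lemma op_e_basis i D : (1 <= i < n)%N ->
  op_e C t v i << D >> = e_scalar i (fdeg D) *:
    \sum_(D' <- additions i D)
      (lambdaL t v i D D' * SchiE C t v i D D' / SchiQ C t v D) *: << D' >>.
Proof.
move=> hi; rewrite /op_e -[X in lin_ext _ X]scale1r lin_ext_scale scale1r.
by rewrite /push_q_L_pull_p lin_ext_scale sum_additions.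
Qed.

Definition degree_size d : nat := (\sum_(1 <= i < n) crd d i)%N.

Lemma crd_incr d i k : (1 <= i < n)%N -> crd (deg_incr d i) k = (crd d k + (k == i))%N.
Proof.
move=> hi; case: k => [|k]; first by rewrite [0%N == i]ltn_eqF //; lia.
have [lt_kn|le_nk] := ltnP k.+1 n; first by rewrite crd_deg_incr.
by rewrite !crd_ge // (_ : k.+1 == i = false) //; lia.
Qed.

Lemma sum_delta (V : nmodType) (G : nat -> V) a b i : (a <= i < b)%N ->
  \sum_(a <= k < b) G k *+ (k == i) = G i.
Proof.
move=> hi; rewrite (bigD1_seq i) ?iota_uniq ?mem_index_iota //= eqxx mulr1n.
by rewrite big1 ?addr0 // => k /negPf ->.
Qed.

Lemma degree_size_incr d i : (1 <= i < n)%N ->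
  degree_size (deg_incr d i) = (degree_size d).+1.
Proof.
move=> hi; rewrite /degree_size; under eq_bigr do rewrite crd_incr //.
rewrite big_split /= -[RHS]addn1; congr addn.
by rewrite (bigD1_seq i) ?iota_uniq ?mem_index_iota //= eqxx big1 // => k /negPf ->.
Qed.

Definition pairing_exponent d : int :=
  \sum_(1 <= i < n) (crd d i)%:Z ^+ 2
  - \sum_(2 <= i < n) (crd d i)%:Z * (crd d i.-1)%:Z
  - \sum_(1 <= i < n) (crd d i)%:Z.

Definition pairing_scalar d : F :=
  (-1) ^+ (\sum_(1 <= i < n) crd d i) * v ^ pairing_exponent d
  * (\prod_(1 <= i < n.+1) t i ^ ((crd d i.-1)%:Z - (crd d i)%:Z)).

Lemma pairing_exponent_incr d i : (1 <= i < n)%N ->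
  pairing_exponent (deg_incr d i) = pairing_exponent d
    + ((crd d i)%:Z *+ 2 - (crd d i.-1)%:Z - (crd d i.+1)%:Z).
Proof.
move=> hi.
(* Since [d_0 = d_n = 0], the mixed sum may be extended at both ends; row [i] then has both
   neighbours inside the range, with no boundary cases. *)
have wide (e : degree n) : \sum_(2 <= i < n) (crd e i)%:Z * (crd e i.-1)%:Z =
    \sum_(1 <= i < n.+1) (crd e i)%:Z * (crd e i.-1)%:Z :> int.
  rewrite [RHS]big_ltn; last by lia.
  rewrite [RHS]addrC big_nat_recr /=; last by lia.
  by rewrite crd_ge // mul0r addr0 mulr0 addr0.
rewrite /pairing_exponent !wide.
have i_in : (1 <= i < n)%N by lia.
have e1 : \sum_(1 <= k < n) (crd (deg_incr d i) k)%:Z ^+ 2 =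
    \sum_(1 <= k < n) (crd d k)%:Z ^+ 2 + ((crd d i)%:Z *+ 2 + 1) :> int.
  rewrite -(sum_delta (fun k => (crd d k)%:Z *+ 2 + 1 : int) i_in) -big_split /=.
  by apply: eq_bigr => k _; rewrite crd_incr // PoszD; case: eqP => _;
    rewrite -?[Posz true]/(1 : int) -?[Posz false]/(0 : int) ?mulr0n ?mulr1n; ring.
have e2 : \sum_(1 <= k < n) (crd (deg_incr d i) k)%:Z =
    \sum_(1 <= k < n) (crd d k)%:Z + 1 :> int.
  rewrite -(sum_delta (fun k => 1 : int) i_in) -big_split /=.
  by apply: eq_bigr => k _; rewrite crd_incr // PoszD; case: eqP => _;
    rewrite -?[Posz true]/(1 : int) -?[Posz false]/(0 : int) ?mulr0n ?mulr1n; ring.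
have e3 : \sum_(1 <= k < n.+1) (crd (deg_incr d i) k)%:Z * (crd (deg_incr d i) k.-1)%:Z =
    \sum_(1 <= k < n.+1) (crd d k)%:Z * (crd d k.-1)%:Z
    + ((crd d i.-1)%:Z + (crd d i.+1)%:Z) :> int.
  have h1 : (1 <= i < n.+1)%N by lia.
  have h2 : (1 <= i.+1 < n.+1)%N by lia.
  rewrite -(sum_delta (fun k => (crd d k.-1)%:Z : int) h1).
  rewrite -(sum_delta (fun k => (crd d k)%:Z : int) h2) -!big_split /=.
  apply: eq_big_nat => -[//|k] _; rewrite !crd_incr //= eqSS !PoszD.
  have [<-|_] := eqVneq k.+1 i.
    rewrite ltn_eqF // -[Posz true]/(1 : int) -[Posz false]/(0 : int).
    by rewrite !mulr0n !mulr1n; ring.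
  by case: eqP => [->|_]; rewrite -?[Posz true]/(1 : int) -?[Posz false]/(0 : int);
    rewrite ?mulr0n ?mulr1n; ring.
by rewrite e1 e2 e3; ring.
Qed.

(** The recursion that a degree-only solution for the pairings with [w] has to satisfy: the second
    factor is the scalar of [e_i] times the value of [sum_lambda_SchiE] without [(1 - v^2)^-1].
    Signs, powers of [v] and powers of [t] cancel separately. *)
Lemma pairing_scalar_incr d i : (1 <= i < n)%N ->
  pairing_scalar (deg_incr d i) * (e_scalar i d
    * (t i ^+ 2 * v ^ (2 * ((crd d i.-1)%:Z - (crd d i)%:Z)))) = pairing_scalar d.
Proof.
move=> hi; rewrite /pairing_scalar pairing_exponent_incr //.
rewrite -/(degree_size _) degree_size_incr // exprS.
have prod_delta (G : nat -> F) k0 : (1 <= k0 < n.+1)%N ->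
    \prod_(1 <= k < n.+1) G k ^+ (k == k0) = G k0.
  move=> hk0; rewrite (bigD1_seq k0) ?iota_uniq ?mem_index_iota //= eqxx expr1.
  by rewrite big1 ?mulr1 // => k /negPf ->.
have -> : \prod_(1 <= k < n.+1) t k ^ ((crd (deg_incr d i) k.-1)%:Z - (crd (deg_incr d i) k)%:Z)
  = \prod_(1 <= k < n.+1) t k ^ ((crd d k.-1)%:Z - (crd d k)%:Z) * (t i.+1 * (t i)^-1).
  have h1 : (1 <= i < n.+1)%N by lia.
  have h2 : (1 <= i.+1 < n.+1)%N by lia.
  rewrite -(prod_delta t _ h2) -(prod_delta (fun k => (t k)^-1) _ h1) -!big_split /=.
  apply: eq_big_nat => k hk; rewrite !crd_incr // !PoszD.
  have -> : k.-1 == i = (k == i.+1) by lia.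
  rewrite opprD addrACA [LHS]expfzDr ?t_neq0 //; congr (_ * _).
  rewrite [LHS]expfzDr ?t_neq0 //; congr (_ * _).
  by rewrite exprVn exprnN.
have ti0 : t i != 0 by apply: t_neq0; lia.
have tSi0 : t i.+1 != 0 by apply: t_neq0; lia.
rewrite /e_scalar expfzDr //.
set X := _ - _ - _; set Y := _ - (crd d i.-1)%:Z; set Z := 2 * _.
have -> : v ^ X = (v ^ Y * v ^ Z)^-1.
  by rewrite -expfzDr // invr_expz; congr (v ^ _); rewrite /X /Y /Z; ring.
by field; rewrite !expfz_neq0 // ti0 tSi0.
Qed.

Lemma pairing_scalar0 : pairing_scalar (deg0 n) = 1.
Proof.
rewrite /pairing_scalar /pairing_exponent !big1 => [||k _|k _|k _|k _]; rewrite ?crd_deg0 //.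
  by rewrite !subr0 expr0 expr0z !mulr1.
by move=> k _; rewrite !crd_deg0 subrr expr0z.
Qed.

Lemma degree_size_ind (P : degree n -> Prop) : P (deg0 n) ->
  (forall d, d != deg0 n ->
     (forall d' i, (1 <= i < n)%N -> deg_incr d' i = d -> P d') -> P d) ->
  forall d, P d.
Proof.
move=> P0 PS d; have [N] := ubnP (degree_size d); elim: N => // N IH in d *.
rewrite ltnS => le_dN; have [->//|ne] := eqVneq d (deg0 n).
apply: PS => // d' i hi e; apply: IH; apply: leq_trans le_dN.
by rewrite -e degree_size_incr.
Qed.

(** Induction on the degree. The candidate [SchiQ] satisfies the same relations as [k d] by
    [sum_SchiE] and the induction hypothesis, so the difference is annihilated by all box-adding
    sums and [additions_inj] applies. *)
Lemma whittaker_f_mcoeff (k : degree n -> KM n F) :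
  is_whittaker v (op_f C t v) k ->
  forall d D, (k d)@_D = if fdeg D == d then SchiQ C t v D else 0.
Proof.
case=> kdeg kvac kop; have kout d D : fdeg D != d -> (k d)@_D = 0.
  by move=> ne; apply: mcoeff_outdom; apply: contra ne => /kdeg/eqP.
apply: degree_size_ind => [D|d ne IH D].
  rewrite kvac mcoeffU; case: eqVneq => [<-|neD].
    by rewrite fdeg_vac eqxx SchiQ_vac.
  case: eqP => // /fdeg_eq_deg0 e; by rewrite e eqxx in neD.
apply/eqP; rewrite -subr_eq0; apply/eqP.
have [->|neD] := eqVneq D (vac n).
  by rewrite kout fdeg_vac 1?eq_sym // (negPf ne) subrr.
apply: (additions_inj (c := fun i D D' => SchiE C t v i D D' / SchiQ C t v D')
          (xi := fun D => (k d)@_D - if fdeg D == d then SchiQ C t v D else 0)) neD.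
  move=> i D1 D2 hi /mem_additions-/(_ hi) /in_corrP-/(_ hi)[p pi ad].
  rewrite mulf_neq0 ?invr_eq0 ?(SchiQ_neq0 C generic) //.
  by rewrite (SchiE_neq0 C generic v_neq0 pi _ ad) //; lia.
move=> i D1 hi; have [ed|ned] := eqVneq (deg_incr (fdeg D1) i) d; last first.
  rewrite big1_seq // => D2 /andP[_ /additions_fdeg e2].
  by rewrite e2 // (negPf ned) kout ?subrr ?mulr0 // e2.
transitivity ((op_f C t v i (k d))@_D1
    - \sum_(D' <- additions i D1) SchiE C t v i D1 D').
  rewrite mcoeff_op_f // -sumrB big_seq [RHS]big_seq; apply: eq_bigr => D2.
  move=> /additions_fdeg e2; rewrite e2 // ed eqxx mulrBr.
  rewrite mulfVK; last exact: (SchiQ_neq0 C generic).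
  by rewrite mulrC.
rewrite sum_SchiE // -[in X in X - _]ed kop // mcoeffZ (IH _ _ hi ed) eqxx.
exact: subrr.
Qed.

(** Pairing [e_i [D1]] with [w d] and moving [e_i] across expresses a weighted sum over additions to
    [D1] through a pairing in lower degree. The degree-only candidate obeys the same relation, and
    [additions_inj] gives uniqueness. *)
Lemma whittaker_e_form (B : KM n F -> KM n F -> F) (estar : nat -> KM n F -> KM n F)
    (w : degree n -> KM n F) :
  is_shapovalov C t v B -> is_e_adjoint C t v B estar -> is_whittaker v estar w ->
  forall d D, fdeg D = d -> B << D >> (w d) = pairing_scalar d.
Proof.
case=> Bsym Blin Bvac _ adj [wdeg wvac wop].
have v1 : 1 - v ^+ 2 != 0 by apply: (subr1_v2_neq0 generic).
apply: degree_size_ind => [D /fdeg_eq_deg0 ->|d ne IH D eD].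
  by rewrite wvac Bvac pairing_scalar0.
have neD : D != vac n by apply: contraNneq ne => e; rewrite -eD e fdeg_vac.
(* Cut off at degree [d], so that the relations landing in any other degree hold trivially; nothing
   is claimed about the pairing of [w d] with other degrees. *)
pose xi D := if fdeg D == d then B << D >> (w d) - pairing_scalar d else 0.
suff : xi D = 0 by rewrite /xi eD eqxx => /eqP; rewrite subr_eq0 => /eqP.
apply: (additions_inj (c := fun i D D' =>
  lambdaL t v i D D' * SchiE C t v i D D' / SchiQ C t v D)) neD.
  move=> i D1 D2 hi /mem_additions-/(_ hi) /in_corrP-/(_ hi)[p pi ad].
  have lt_in : (i < n)%N by lia.
  rewrite !mulf_neq0 ?invr_eq0 ?(SchiQ_neq0 C generic) //
    ?(SchiE_neq0 C generic v_neq0 pi _ ad) //.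
  by rewrite (lambdaL_add _ _ pi lt_in ad) sp_neq0 //; lia.
move=> i D1 hi; have [ed|ned] := eqVneq (deg_incr (fdeg D1) i) d; last first.
  rewrite big1_seq // => D2 /andP[_ /additions_fdeg e2].
  by rewrite /xi e2 // (negPf ned) mulr0.
have e0 : e_scalar i (fdeg D1) != 0.
  by rewrite oppr_eq0 !mulf_neq0 ?invr_eq0 ?expfz_neq0 ?t_neq0 //; lia.
apply: (mulfI e0); rewrite mulr0.
transitivity (B (op_e C t v i << D1 >>) (w d) - e_scalar i (fdeg D1) *
    (\sum_(D' <- additions i D1) lambdaL t v i D1 D' * SchiE C t v i D1 D' / SchiQ C t v D1)
    * pairing_scalar d).
  rewrite op_e_basis // pairingZl // pairing_suml // -mulrA -mulrBr.
  rewrite mulr_suml -sumrB; congr (_ * _).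
  rewrite big_seq [RHS]big_seq; apply: eq_bigr => D2.
  by move=> /additions_fdeg e2; rewrite /xi e2 // ed eqxx mulrBr.
rewrite adj // -[in X in X - _]ed wop // pairingZr // (IH _ _ hi ed) //.
rewrite sum_lambda_SchiE // -(pairing_scalar_incr (fdeg D1) hi) ed.
by ring.
Qed.

Lemma shapovalov_whittaker (B : KM n F -> KM n F -> F) (estar : nat -> KM n F -> KM n F)
    (k w : degree n -> KM n F) :
  is_shapovalov C t v B -> is_e_adjoint C t v B estar ->
  is_whittaker v (op_f C t v) k -> is_whittaker v estar w ->
  forall d, B (k d) (w d) = pairing_scalar d * RGammaQ C t v d.
Proof.
move=> hB adj hk hw d; have [Bsym Blin _ _] := hB.
rewrite pairing_msupp // /RGammaQ (fsbigE (msupp (k d))).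
- rewrite mulr_sumr big_seq [RHS]big_seq_cond.
  have degk D : D \in msupp (k d) -> fdeg D = d by apply: (whittaker_deg hk).
  apply: eq_big => [D|D Dk].
    by case: (boolP (D \in msupp _)) => //= /degk e; rewrite mem_set.
  rewrite (whittaker_e_form hB adj hw) ?degk // (whittaker_f_mcoeff hk) degk // eqxx.
  exact: mulrC.
- exact: fset_uniq.
- by move=> D /(whittaker_deg hk).
(* Since [SchiQ] never vanishes, the support of [k d] is the whole set of fixed points of degree
   [d]. *)
- move=> D /= e; rewrite -mcoeff_eq0 (whittaker_f_mcoeff hk) e eqxx => h.
  by have := SchiQ_neq0 C generic v_neq0 D n_gt0; rewrite h.
Qed.

End Pairing.

(** * Independence of the torus coordinates *)

Section TorusGeneric.
Import mpoly.
Variables (R : realType) (n : nat) (e : bool).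
Local Notation P := {poly mpoly n.-1 R[i]}.

(* Specialization at t_j = 2^j for j < n and v = 2^e. *)
Definition spec (p : P) : R[i] :=
  meval (fun k : 'I_n.-1 => 2 ^+ k.+1) p.[mpolyC _ (2 ^+ e)].

Lemma specM p q : spec (p * q) = spec p * spec q.
Proof. by rewrite /spec hornerM mevalM. Qed.

(** [spec] is defined on polynomials only; a fraction takes the value [2 ^ w] when some
    representation of it has a denominator that survives the specialization. *)
Definition specializes (r : ratT R n) (w : int) : Prop :=
  exists a b : P, [/\ r * tofrac b = tofrac a, spec b != 0 & spec a = 2 ^ w * spec b].

Lemma two_neq0 : (2 : R[i]) != 0.
Proof. by rewrite pnatr_eq0. Qed.

Lemma specializes_poly (p : P) w : spec p = 2 ^ w -> specializes (tofrac p) w.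
Proof.
move=> e1; exists p, 1; rewrite /spec hornerC meval1 tofrac1 !mulr1; split=> //.
exact: oner_neq0.
Qed.

Lemma specializes1 w : specializes 1 w -> w = 0.
Proof.
case=> a [b [/eqP]]; rewrite mul1r tofrac_eq => /eqP <- nz.
rewrite -[LHS]mul1r => /(mulIf nz) /esym/eqP.
have pow2 k : (2 ^+ k == 1 :> R[i]) = (k == 0%N).
  by rewrite -natrX -[1]/(1%:R) eqr_nat -(expn0 2) eqn_exp2l.
case: w => k; first by rewrite -exprnP pow2 => /eqP ->.
by rewrite NegzE -exprnN invr_eq1 pow2.
Qed.

Lemma specializesM r1 r2 w1 w2 : specializes r1 w1 -> specializes r2 w2 ->
  specializes (r1 * r2) (w1 + w2).
Proof.
case=> a1 [b1 [h1 n1 s1]] [a2 [b2 [h2 n2 s2]]]; exists (a1 * a2), (b1 * b2); split.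
- by rewrite !tofracM mulrACA h1 h2.
- by rewrite specM mulf_neq0.
- by rewrite !specM s1 s2 expfzDr ?two_neq0 // mulrACA.
Qed.

Lemma specializes_neq0 r w : specializes r w -> r != 0.
Proof.
case=> a [b [h nb s]].
have : spec a != 0 by rewrite s mulf_neq0 // expfz_neq0 // two_neq0.
apply: contraNneq => r0; move/esym/eqP: h; rewrite r0 mul0r tofrac_eq0 => /eqP ->.
by rewrite /spec horner0 meval0.
Qed.

Lemma specializesV r w : specializes r w -> specializes r^-1 (- w).
Proof.
move=> hr; have r_neq0 := specializes_neq0 hr; case: hr => a [b [h nb s]].
have na : spec a != 0 by rewrite s mulf_neq0 // expfz_neq0 // two_neq0.
exists b, a; split=> //; first by rewrite -h mulrA mulVf // mul1r.
by rewrite s -invr_expz mulrA mulVf ?mul1r // expfz_neq0 // two_neq0.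
Qed.

Lemma specializes_one : specializes 1 0.
Proof. by rewrite -tofrac1; apply: specializes_poly; rewrite /spec hornerC meval1. Qed.

Lemma specializes_expn r w k : specializes r w -> specializes (r ^+ k) (w * k%:Z).
Proof.
move=> h; elim: k => [|k IH]; first by rewrite mulr0; apply: specializes_one.
by rewrite exprS intS mulrDr mulr1; apply: specializesM.
Qed.

Lemma specializes_expz r w s : specializes r w -> specializes (r ^ s) (w * s).
Proof.
move=> h; case: s => k; first exact: specializes_expn.
by rewrite NegzE mulrN -invr_expz; apply/specializesV/specializes_expn.
Qed.

(** The exponent of 2 in the specialized [t_j]. That of [t_n] is negative or zero, being minus the
    sum of the others, so the weights of [t_1, ..., t_n] are distinct. *)
Definition weight (j : nat) : int :=
  if (j < n)%N then j%:Z else - (\sum_(k < n.-1) k.+1)%N%:Z.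

Lemma specializes_tT0 k : specializes (tT0 R k) k.+1.
Proof. by apply: specializes_poly; rewrite /spec hornerC mevalXU. Qed.

Lemma specializes_tT j : (1 <= j <= n)%N -> specializes (tT R n j) (weight j).
Proof.
move=> hj; rewrite /tT /weight; case: insubP => [k lt_k ek|].
  rewrite ifT; last by lia.
  by rewrite -[j]prednK -?ek; [apply: specializes_tT0|lia].
rewrite -leqNgt => le_n; rewrite ifF; last by lia.
apply: specializesV; elim/big_rec2: _ => [|k r w _ IH]; first exact: specializes_one.
by rewrite PoszD; apply: specializesM => //; apply: specializes_tT0.
Qed.

Lemma specializes_vT : specializes (vT R n) e.
Proof. by apply: specializes_poly; rewrite /spec hornerX mevalC. Qed.

Lemma weight_inj j m : (1 <= j <= n)%N -> (1 <= m <= n)%N ->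
  weight j = weight m -> j = m.
Proof. by rewrite /weight; case: ifP; case: ifP; lia. Qed.

Lemma specializes_character j m s : (1 <= j <= n)%N -> (1 <= m <= n)%N ->
  tT R n m ^+ 2 * tT R n j ^- 2 * vT R n ^ (2 * s) = 1 ->
  weight m - weight j + e%:Z * s = 0.
Proof.
move=> hj hm eq1.
suff : specializes 1 (weight m * 2 + - (weight j * 2) + e%:Z * (2 * s)).
  by move/specializes1; lia.
rewrite -eq1; apply: specializesM; last by apply: specializes_expz specializes_vT.
by apply: specializesM; [|apply: specializesV];
  apply: specializes_expn; apply: specializes_tT.
Qed.

End TorusGeneric.

(** At [v = 1] the specialized relation compares the weights of [t_m] and [t_j] and gives [m = j];
    at [v = 2] it then leaves [s = 0]. *)
Lemma torus_generic (R : realType) n j m s : (1 <= j <= n)%N -> (1 <= m <= n)%N ->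
  tT R n m ^+ 2 * tT R n j ^- 2 * vT R n ^ (2 * s) = 1 -> m = j /\ s = 0.
Proof.
move=> hj hm eq1.
have := specializes_character false hj hm eq1.
have := specializes_character true hj hm eq1.
rewrite !mul0r !mul1r => h1 h0.
have e : m = j by apply: (weight_inj hm hj); lia.
by split=> //; move: h1; rewrite e; lia.
Qed.

Lemma vT_neq0 (R : realType) n : vT R n != 0.
Proof. exact: specializes_neq0 (specializes_vT R n false). Qed.

Lemma tT_neq0 (R : realType) n j : (1 <= j <= n)%N -> tT R n j != 0.
Proof. by move=> hj; apply: specializes_neq0 (specializes_tT R false hj). Qed.

Theorem corollary2p32 (R : realType) (n : nat) (hn : (2 <= n)%N)
    (B : KM n (ratT R n) -> KM n (ratT R n) -> ratT R n)
    (hB : is_shapovalov R[i] (@tT R n) (vT R n) B)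
    (estar : nat -> KM n (ratT R n) -> KM n (ratT R n))
    (hestar : is_e_adjoint R[i] (@tT R n) (vT R n) B estar)
    (k w : degree n -> KM n (ratT R n))
    (hk : is_whittaker (vT R n) (op_f R[i] (@tT R n) (vT R n)) k)
    (hw : is_whittaker (vT R n) estar w)
    (d : degree n) :
  B (k d) (w d) =
    (-1) ^+ (\sum_(1 <= i < n) crd d i)
    * vT R n ^ (\sum_(1 <= i < n) (crd d i)%:Z ^+ 2
                - \sum_(2 <= i < n) (crd d i)%:Z * (crd d i.-1)%:Z
                - \sum_(1 <= i < n) (crd d i)%:Z)
    * (\prod_(1 <= i < n.+1) tT R n i ^ ((crd d i.-1)%:Z - (crd d i)%:Z))
    * RGammaQ R[i] (@tT R n) (vT R n) d.
Proof.
have n_gt0 : (0 < n)%N by lia.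
exact: (shapovalov_whittaker n_gt0 (@torus_generic R n) (@tT_neq0 R n)
  (vT_neq0 R n) hB hestar hk hw).
Qed.
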